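(* Let $0<\alpha<\pi/6$ with $\frac{\alpha}{\pi}$ irrational, and let $\overline F$ be the random billiard map in the unit circle, $\overline F(s,\theta)=(s+2T_i(\theta)\bmod 2\pi,\ T_i(\theta))$ with probability $p_i(\theta)$, where $T_i,p_i$ ($i=1,\dots,4$) are the maps and probabilities of the Feres Random Map with parameter $\alpha$. Let $\lambda$ be normalized Lebesgue measure on $[0,2\pi)$ and $\mu(B)=\frac12\int_B\sin\theta\,d\theta$. Let $\nu=\nu_1\times\nu_2$ with $\nu_1=\lambda$ and $d\nu_2=g\,d\mu$, where $g\ge 0$ is measurable with $\int g\,d\mu=1$. Then for all Borel sets $A\subset[0,2\pi)$, $B\subset(0,\pi)$ and all $n$, $$\nu^{(n)}(A\times B)=\nu_1^{(n)}(A)\,\nu_2^{(n)}(B),$$ and $$\nu^{(n)}(A\times B)\longrightarrow(\lambda\times\mu)(A\times B)\quad\text{as } n\to\infty.$$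
   Context: Feres Random Map. Fix $0<\alpha<\pi/6$. Put $T_1(\theta)=\theta+2\alpha$, $T_2(\theta)=-\theta+2\pi-4\alpha$, $T_3(\theta)=\theta-2\alpha$, $T_4(\theta)=-\theta+4\alpha$, and $u_a(\theta)=\frac12\left(1+\frac{\tan a}{\tan\theta}\right)$ (with $1/\tan(\pi/2)=0$). Define functions $p_i:[0,\pi]\to[0,1]$ by: $p_1(\theta)=1$ on $[0,\alpha)$, $u_\alpha(\theta)$ on $[\alpha,\pi-3\alpha)$, $2\cos(2\alpha)u_{2\alpha}(\theta)$ on $[\pi-3\alpha,\pi-2\alpha)$, $0$ on $[\pi-2\alpha,\pi]$; $p_2(\theta)=0$ on $[0,\pi-3\alpha)$, $u_\alpha(\theta)-2\cos(2\alpha)u_{2\alpha}(\theta)$ on $[\pi-3\alpha,\pi-2\alpha)$, $u_\alpha(\theta)$ on $[\pi-2\alpha,\pi-\alpha)$, $0$ on $[\pi-\alpha,\pi]$; $p_3(\theta)=0$ on $[0,2\alpha)$, $2\cos(2\alpha)u_{2\alpha}(-\theta)$ on $[2\alpha,3\alpha)$, $u_\alpha(-\theta)$ on $[3\alpha,\pi-\alpha)$, $1$ on $[\pi-\alpha,\pi]$; $p_4(\theta)=0$ on $[0,\alpha)$, $u_\alpha(-\theta)$ on $[\alpha,2\alpha)$, $u_\alpha(-\theta)-2\cos(2\alpha)u_{2\alpha}(-\theta)$ on $[2\alpha,3\alpha)$, $0$ on $[3\alpha,\pi]$. The Feres Random Map $T$ sends $\theta$ to $T_i(\theta)$ with probability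 $p_i(\theta)$, $i=1,2,3,4$. Evolution of measures. Write $\overline F_i(s,\theta)=(s+2T_i(\theta)\bmod 2\pi,\ T_i(\theta))$. For a probability measure $\nu$ on $[0,2\pi)\times(0,\pi)$ put $\nu^{(0)}=\nu$ and $\nu^{(n+1)}(C)=\int K((s,\theta),C)\,d\nu^{(n)}(s,\theta)$, where $K((s,\theta),C)=\sum_{i=1}^4 p_i(\theta)\mathbf 1_C(\overline F_i(s,\theta))$. For the probability measure $\nu_2$ on $(0,\pi)$ put $\nu_2^{(0)}=\nu_2$ and $\nu_2^{(n+1)}(B)=\int\sum_{i=1}^4 p_i(\theta)\mathbf 1_B(T_i(\theta))\,d\nu_2^{(n)}(\theta)$. $\nu_1^{(n)}$ denotes the first marginal of $\nu^{(n)}$, $\nu_1^{(n)}(A)=\nu^{(n)}(A\times(0,\pi))$. *)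

(* Defs.v *)
From HB Require Import structures.
From mathcomp Require Import all_boot all_order all_algebra.
From mathcomp Require Import all_classical all_reals all_analysis.
From mathcomp Require Import measurable_realfun lra.

Set Implicit Arguments.
Unset Strict Implicit.
Unset Printing Implicit Defensive.

Import Order.TTheory GRing.Theory Num.Theory.
Import numFieldNormedType.Exports.

Local Open Scope classical_set_scope.
Local Open Scope ring_scope.

Section feres_map.
Context {R : realType}.
Implicit Types (a alpha theta x : R).

(* Indices are shifted by one: feresT _ i and feresp _ i are T_{i+1} and
   p_{i+1}. *)
Definition feresT alpha (i : 'I_4) theta : R :=
  match val i with
  | 0 => theta + 2 * alpha
  | 1 => - theta + 2 * pi - 4 * alpha
  | 2 => theta - 2 * alpha
  | _ => - theta + 4 * alpha
  end.

(* Division by 0 is 0, so at theta = pi / 2 we have tan theta = 1 / 0 = 0 and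
   tan a / tan theta = 0, in accordance with the convention
   1 / tan (pi / 2) = 0. *)
Definition feresu a theta : R := 2^-1 * (1 + tan a / tan theta).

(* p_i is only defined on [0, pi]; the values given outside are junk, and the
   integrals below only range over theta in (0, pi). *)
Definition feresp alpha (i : 'I_4) theta : R :=
  match val i with
  | 0 => if theta < alpha then 1
         else if theta < pi - 3 * alpha then feresu alpha theta
         else if theta < pi - 2 * alpha
              then 2 * cos (2 * alpha) * feresu (2 * alpha) theta
         else 0
  | 1 => if theta < pi - 3 * alpha then 0
         else if theta < pi - 2 * alpha
              then feresu alpha theta
                   - 2 * cos (2 * alpha) * feresu (2 * alpha) theta
         else if theta < pi - alpha then feresu alpha theta
         else 0
  | 2 => if theta < 2 * alpha then 0
         else if theta < 3 * alpha
              then 2 * cos (2 * alpha) * feresu (2 * alpha) (- theta)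
         else if theta < pi - alpha then feresu alpha (- theta)
         else 1
  | _ => if theta < alpha then 0
         else if theta < 2 * alpha then feresu alpha (- theta)
         else if theta < 3 * alpha
              then feresu alpha (- theta)
                   - 2 * cos (2 * alpha) * feresu (2 * alpha) (- theta)
         else 0
  end.

Definition mod2pi x : R := x - 2 * pi * (Num.floor (x / (2 * pi)))%:~R.

Definition positions : set R := `[0, 2 * pi[.
Definition angles : set R := `]0, pi[.

Definition billiardF alpha (i : 'I_4) (x : R * R) : R * R :=
  (mod2pi (x.1 + 2 * feresT alpha i x.2), feresT alpha i x.2).

Definition billiardK alpha (x : R * R) (C : set (R * R)) : \bar R :=
  (\sum_(i < 4) feresp alpha i x.2 * \1_C (billiardF alpha i x))%:E.

Definition feresK alpha theta (B : set R) : \bar R :=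
  (\sum_(i < 4) feresp alpha i theta * \1_B (feresT alpha i theta))%:E.

End feres_map.

Local Open Scope ereal_scope.

Section evolution.
Context {R : realType}.
Implicit Types alpha : R.

(* The iterates are set functions defined by integration against the previous
   iterate. For 0 < alpha < pi / 6 the p_i are nonnegative and sum to 1 on
   (0, pi), so that the iterates are measures if nu is. *)
Fixpoint billiard_evol alpha (nu : set (R * R) -> \bar R) (n : nat) :
    set (R * R) -> \bar R :=
  if n is m.+1 then fun C =>
    \int[billiard_evol alpha nu m]_(x in positions `*` angles)
      billiardK alpha x C
  else nu.

Fixpoint feres_evol alpha (nu : set R -> \bar R) (n : nat) :
    set R -> \bar R :=
  if n is m.+1 then fun B =>
    \int[feres_evol alpha nu m]_(theta in angles) feresK alpha theta B
  else nu.

Definition position_marginal (nu : set (R * R) -> \bar R) (A : set R) :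
  \bar R := nu (A `*` angles).

End evolution.

(* Measures on [0, 2 * pi) and on (0, pi) are represented as measures on R
   that are concentrated on these intervals. *)
Section measures.
Context {R : realType}.
Local Notation leb := (@lebesgue_measure R).

Definition circle_measure (A : set R) : \bar R :=
  ((2 * pi)^-1)%:E * leb (A `&` positions).

Definition sine_measure (B : set R) : \bar R :=
  (2^-1)%:E * \int[leb]_(theta in B `&` angles) (sin theta)%:E.

Definition sine_density (g : R -> R) (B : set R) : \bar R :=
  \int[sine_measure]_(theta in B `&` angles) (g theta)%:E.

Let measurable_positions : measurable (positions : set R).
Proof. exact: measurable_itv. Qed.

Let measurable_angles : measurable (angles : set R).
Proof. exact: measurable_itv. Qed.

Let c_ge0 : (0 <= (2 * pi : R)^-1)%R.
Proof. by rewrite invr_ge0 mulr_ge0 ?pi_ge0. Qed.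

Let circle_measureE : circle_measure =
  mscale (NngNum c_ge0) (mrestr leb measurable_positions).
Proof. by []. Qed.

Let circle0 : circle_measure set0 = 0.
Proof. by rewrite circle_measureE measure0. Qed.

Let circle_ge0 A : 0 <= circle_measure A.
Proof. by rewrite circle_measureE. Qed.

Let circle_sigma_additive : semi_sigma_additive circle_measure.
Proof. by rewrite circle_measureE; exact: (@measure_semi_sigma_additive _ _ _
  (mscale (NngNum c_ge0) (mrestr leb measurable_positions))). Qed.

HB.instance Definition _ := isMeasure.Build _ _ _ circle_measure
  circle0 circle_ge0 circle_sigma_additive.

Let circleT : circle_measure setT = 1.
Proof.
rewrite /circle_measure setTI /positions lebesgue_measure_itv/= lte_fin.
have p0 : (0 < 2 * pi :> R)%R by rewrite mulr_gt0 ?pi_gt0.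
by rewrite p0 sube0 -EFinM mulVf// gt_eqF.
Qed.

HB.instance Definition _ := Measure_isProbability.Build _ _ _ circle_measure
  circleT.

Let measurable_sin (D : set R) : measurable_fun D (@sin R).
Proof.
apply: measurable_funTS.
by apply: continuous_measurable_fun; exact: continuous_sin.
Qed.

Let sin_angles (B : set R) theta : (B `&` angles) theta ->
  0 <= (sin theta)%:E.
Proof.
move=> [_]; rewrite /angles /= in_itv/= => /andP[t0 tpi].
by rewrite lee_fin sin_ge0_pi// !ltW.
Qed.

Let sine0 : sine_measure set0 = 0.
Proof. by rewrite /sine_measure set0I integral_set0 mule0. Qed.

Let sine_ge0 B : 0 <= sine_measure B.
Proof.
apply: mule_ge0; first by rewrite lee_fin invr_ge0.
by apply: integral_ge0 => x /sin_angles.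
Qed.

Let sine_sigma_additive : semi_sigma_additive sine_measure.
Proof.
move=> F mF tF mUF; rewrite /sine_measure setI_bigcupl.
have mFI i : measurable (F i `&` angles) by exact: measurableI.
rewrite ge0_integral_bigcup//; last 3 first.
- by apply/measurable_EFinP; exact: measurable_sin.
- move=> x [k _ Fx]; exact: (sin_angles Fx).
- exact: trivIset_setIr.
rewrite -(nneseriesZl _ 0%N); last by move=> i _; apply: integral_ge0 => x /sin_angles.
apply: cvg_toP => //.
by apply: is_cvg_ereal_nneg_natsum => n _; exact: (sine_ge0 (F n)).
Qed.

HB.instance Definition _ := isMeasure.Build _ _ _ sine_measure
  sine0 sine_ge0 sine_sigma_additive.

Let sineT : sine_measure setT = 1.
Proof.
rewrite /sine_measure setTI /angles.
have -> : \int[leb]_(theta in `]0%R, (pi : R)[) (sin theta)%:E =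
    \int[leb]_(theta in `[0%R, (pi : R)]) (sin theta)%:E.
  rewrite (integral_itv_bndoo true false)//.
  by apply/measurable_EFinP; exact: measurable_sin.
rewrite (@continuous_FTC2 _ sin (fun x => - cos x)%R)//.
- rewrite cospi cos0 !opprK -EFinB -EFinM; congr EFin; lra.
- exact: pi_gt0.
- by apply: continuous_subspaceT => x; exact: continuous_sin.
- have cN : continuous (fun x : R => - cos x)%R.
    by move=> x; apply: cvgN; exact: continuous_cos.
  split=> //.
  + by apply: cvg_at_right_filter; exact: cN.
  + by apply: cvg_at_left_filter; exact: cN.
- by move=> x _; rewrite derive1N// derive1E derive_val opprK.
Qed.

HB.instance Definition _ := Measure_isProbability.Build _ _ _ sine_measure
  sineT.

End measures.

(* Main.v *)
(* Proof idea. Put W = sin on (0, pi) and q_i = p_i W. The weights satisfy the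
   detailed balance q_1(x) = q_3(T_1 x), q_2(x) = q_2(T_2 x),
   q_4(x) = q_4(T_4 x), so the Markov operator P f = sum_i p_i (f o T_i) is
   self-adjoint in L^2(mu). Hence nu_2^(n) has the density P^n g with respect to
   mu, and, lambda being invariant under rotations,
   nu^(n) = lambda x nu_2^(n).

   It remains to see that int g P^n 1_B dmu tends to mu(B). Let f_n = P^n 1_B.
   The energies int f_n^2 dmu decrease, and their increments dominate
   int W (p_i p_j) (f_n o T_i - f_n o T_j)^2, which therefore tends to 0. Thus
   f_n is asymptotically invariant, in mean, under the translation by 4 alpha
   (from T_1 and T_3) and under the reflections at 3 alpha (T_1 and T_4) and at
   pi - 3 alpha (T_2 and T_3). For the primitive Phi_n of f_n, extended to the
   line so as to be 4 alpha-periodic up to a linear term, composing the two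
   reflections gives asymptotic invariance under the translation by 2 pi. As
   alpha / pi is irrational, Phi_n is asymptotically linear, that is, f_n minus
   its mean tends weakly to 0 on intervals, then on Borel sets and against
   integrable functions. *)
Require Import Defs.
From HB Require Import structures.
From mathcomp Require Import all_boot all_order all_algebra.
From mathcomp Require Import all_classical all_reals all_analysis.
From mathcomp Require Import measurable_realfun ring lra.

Set Implicit Arguments.
Unset Strict Implicit.
Unset Printing Implicit Defensive.

Import Order.TTheory GRing.Theory Num.Theory.
Import numFieldNormedType.Exports.

Local Open Scope classical_set_scope.
Local Open Scope ring_scope.

(** * Weights *)

(** Why [P^n] is moved from [g] to [1_B]: [g] is merely integrable and [P^n g] may have infinite
    energy, whereas the [f_n] take values in [0, 1]. This gives finite energies, and primitives
    [Phi_n] that are Lipschitz uniformly in [n]. The dissipated energy says something only where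
    both weights [p_i], [p_j] are positive, so each asymptotic invariance is known on a subinterval
    of (0, pi) only and the reflections cannot be composed there. This is what forces the extension
    to the line. Invariance under the translation by 2 pi is first obtained up to a drift [delta_n]
    that does not depend on the point. Repeating the translation [m] times multiplies the drift by
    [m], while the periodic part of the primitive oscillates by at most 4 alpha; hence [delta_n]
    tends to 0. The mean of [f_n] is not known to converge in advance. It is identified by testing
    against [sin], since the integral of [f_n sin] is conserved. The iterates are bare set
    functions, controlled on measurable sets only; they are compared there with measures given by
    densities. *)

Section feres_weights.
Context {R : realType} (alpha : R).
Hypothesis halpha : 0 < alpha < pi / 6.
Implicit Types (a x y : R) (i : 'I_4).

Definition sinpos x : R := if 0 < x < pi then sin x else 0.

(** The extension by 0 makes detailed balance true on the whole line, where the [T_i] are bijective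
    isometries; integrals over [R] then need no care about angles leaving (0, pi). *)
Definition feresq i x : R := if 0 < x < pi then feresp alpha i x * sin x else 0.

Definition feresinv i : 'I_4 :=
  match val i with
  | 0 => @Ordinal 4 2 isT
  | 1 => @Ordinal 4 1 isT
  | 2 => @Ordinal 4 0 isT
  | _ => @Ordinal 4 3 isT
  end.

Lemma feresinvK : involutive feresinv.
Proof. by move=> [[|[|[|[|]]]] // i4]; exact: val_inj. Qed.

Lemma feresTK i : cancel (feresT alpha i) (feresT alpha (feresinv i)).
Proof. by move=> x; case: i => [[|[|[|[|]]]] // i4]; rewrite /feresT /=; ring. Qed.

Lemma sinpos_ge0 x : 0 <= sinpos x.
Proof. by rewrite /sinpos; case: ifP => // xpi; rewrite ltW// sin_gt0_pi. Qed.

Lemma sinpos_le1 x : sinpos x <= 1.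
Proof. by rewrite /sinpos; case: ifP => // _; exact: sin_le1. Qed.

Lemma feresu_sin a x : cos a != 0 -> sin x != 0 ->
  feresu a x * sin x = sin (x + a) / (2 * cos a).
Proof.
move=> a0 x0; rewrite /feresu /tan sinD.
(* Here [tan x] and its inverse are both 0, and the claim is [sin (x + a) = sin x * cos a]. *)
have [c0|c0] := eqVneq (cos x) 0; first by rewrite c0 invr0 mulr0 invr0; field.
by field; rewrite a0 c0 x0.
Qed.

Lemma feresuN_sin a x : cos a != 0 -> sin x != 0 ->
  feresu a (- x) * sin x = sin (x - a) / (2 * cos a).
Proof.
move=> a0 x0; rewrite -[X in _ * X]opprK -sinN mulrN feresu_sin ?sinN ?oppr_eq0//.
by rewrite -mulNr -sinN opprD opprK.
Qed.

Let cosa_gt0 : 0 < cos alpha.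
Proof. by apply: cos_gt0_pihalf; have [? ?] := andP halpha; apply/andP; split; lra. Qed.

Let cos2a_gt0 : 0 < cos (2 * alpha).
Proof. by apply: cos_gt0_pihalf; have [? ?] := andP halpha; apply/andP; split; lra. Qed.

Let s1 x := sin (x + alpha) / (2 * cos alpha).
Let s3 x := sin (x - alpha) / (2 * cos alpha).

(** Multiplication by the sine removes all tangents: [u_a] becomes a shifted sine over [2 * cos a],
    and the factor [2 * cos (2 * alpha)] cancels that denominator. *)
Lemma feresqE i x : feresq i x =
  if 0 < x < pi then
    match val i with
    | 0 => if x < alpha then sin x
           else if x < pi - 3 * alpha then s1 x
           else if x < pi - 2 * alpha then sin (x + 2 * alpha) else 0
    | 1 => if x < pi - 3 * alpha then 0
           else if x < pi - 2 * alpha then s1 x - sin (x + 2 * alpha)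
           else if x < pi - alpha then s1 x else 0
    | 2 => if x < 2 * alpha then 0
           else if x < 3 * alpha then sin (x - 2 * alpha)
           else if x < pi - alpha then s3 x else sin x
    | _ => if x < alpha then 0
           else if x < 2 * alpha then s3 x
           else if x < 3 * alpha then s3 x - sin (x - 2 * alpha)
           else 0
    end
  else 0.
Proof.
rewrite /feresq; case: ifP => // /[dup] xpi /sin_gt0_pi/lt0r_neq0 sx0.
have cc : 2 * cos (2 * alpha) != 0 by rewrite mulf_neq0// gt_eqF.
have c1 : cos alpha != 0 by rewrite gt_eqF.
have c2 : cos (2 * alpha) != 0 by rewrite gt_eqF.
have u1 : feresu alpha x * sin x = s1 x by exact: feresu_sin.
have u3 : feresu alpha (- x) * sin x = s3 x by exact: feresuN_sin.
have v1 : 2 * cos (2 * alpha) * feresu (2 * alpha) x * sin x = sin (x + 2 * alpha).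
  by rewrite -[LHS]mulrA feresu_sin// mulrC divfK.
have v3 : 2 * cos (2 * alpha) * feresu (2 * alpha) (- x) * sin x =
    sin (x - 2 * alpha).
  by rewrite -[LHS]mulrA feresuN_sin// mulrC divfK.
case: i => [[|[|[|[|]]]] // i4]; rewrite /feresp /=;
  do ?[case: ifP => _]; by rewrite ?mulrBl ?mul0r ?mul1r ?u1 ?u3 ?v1 ?v3.
Qed.

Let sin_2piB x : sin (- x + 2 * pi) = - sin x.
Proof. by rewrite mulr_natl sinD sin2pi cos2pi mulr0 mulr1 addr0 sinN. Qed.

(** [T_2] is the reflection at pi - 2 alpha, and by the sum formula for
    [sin (y + alpha) + sin (y - alpha)] with [y = x + 2 * alpha] it exchanges the two nonzero
    branches of [q_2]. The next identity does the same for [T_4], the reflection at 2 alpha, and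
    [q_4]. *)
Let s1_reflect x : s1 (- x + 2 * pi - 4 * alpha) = s1 x - sin (x + 2 * alpha).
Proof.
have E1 : - x + 2 * pi - 4 * alpha + alpha = - (x + 2 * alpha + alpha) + 2 * pi.
  by ring.
rewrite /s1 E1 sin_2piB.
have -> : sin (x + alpha) = sin (x + 2 * alpha - alpha) by congr sin; ring.
by rewrite (sinD _ alpha) (sinB _ alpha); field; rewrite gt_eqF.
Qed.

Let s3_reflect x : s3 (- x + 4 * alpha) = s3 x - sin (x - 2 * alpha).
Proof.
have E1 : - x + 4 * alpha - alpha = - (x - 2 * alpha - alpha) by ring.
rewrite /s3 E1 sinN.
have -> : sin (x - alpha) = sin (x - 2 * alpha + alpha) by congr sin; ring.
by rewrite (sinD _ alpha) (sinB _ alpha); field; rewrite gt_eqF.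
Qed.

Let s1_pi x : x = pi - alpha -> s1 x = 0.
Proof. by move=> ->; rewrite /s1 subrK sinpi mul0r. Qed.

Let s3_pi x : x = alpha -> s3 x = 0.
Proof. by move=> ->; rewrite /s3 subrr sin0 mul0r. Qed.

(** Detailed balance at every real point: the breakpoints of both sides correspond under [T_i], and
    wherever the half-open ends do not match, the weights vanish. *)
Lemma feresq_sym i x : feresq (feresinv i) (feresT alpha i x) = feresq i x.
Proof.
have S x1 x2 : x1 = x2 -> sin x1 = sin x2 by move=> ->.
have [a0 a6] := andP halpha.
have eq_cond (b1 b2 : bool) : (b1 -> b2) -> (b2 -> b1) -> b1 = b2.
  by move=> *; apply/idP/idP.
have H0 y : feresq (@Ordinal 4 0 isT) y = feresq (@Ordinal 4 2 isT) (y + 2 * alpha).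
  rewrite !feresqE /=.
  have -> : (y + 2 * alpha < pi) = (y < pi - 2 * alpha) by apply: eq_cond => ?; lra.
  have -> : (y + 2 * alpha < 2 * alpha) = (y < 0) by apply: eq_cond => ?; lra.
  have -> : (y + 2 * alpha < 3 * alpha) = (y < alpha) by apply: eq_cond => ?; lra.
  have -> : (y + 2 * alpha < pi - alpha) = (y < pi - 3 * alpha).
    by apply: eq_cond => ?; lra.
  have s13 : s3 (y + 2 * alpha) = s1 y by congr (_ / _); apply: S; ring.
  rewrite s13 (_ : y + 2 * alpha - 2 * alpha = y); last by ring.
  (* At [y = 0] the left side is 0 by the cutoff, the right side because its branch is [sin 0]. *)
  case: (ltgtP 0 y) => [y0|y0|<-]; rewrite ?sin0 /=; last by rewrite a0 if_same.
    have -> : 0 < y + 2 * alpha by lra.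
    case: (ltP y (pi - 2 * alpha)) => y1 /=.
      by have -> : y < pi by lra.
    have -> : y < alpha = false by apply/negbTE; rewrite -leNgt; lra.
    have -> : y < pi - 3 * alpha = false by apply/negbTE; rewrite -leNgt; lra.
    by rewrite if_same.
  by rewrite if_same.
have H1 y : feresq (@Ordinal 4 1 isT) (- y + 2 * pi - 4 * alpha) = feresq (@Ordinal 4 1 isT) y.
  (* [T_2] turns the half-open support of [q_2] into one closed at the other end, so [q_2] has to
     vanish at pi - 3 alpha as well; there its branch equals [s1 (pi - alpha) = 0]. *)
  have zero z : pi - 3 * alpha < z < pi - alpha = false -> feresq (@Ordinal 4 1 isT) z = 0.
    rewrite feresqE /=; case: ifP => // _.
    case: (ltgtP z (pi - 3 * alpha)) => [//|z1|->] /=.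
      have -> : z < pi - 2 * alpha = (z < pi - 2 * alpha) && (z < pi - alpha).
        by apply: eq_cond => [?|/andP[]//]; apply/andP; split; lra.
      by move=> ->; rewrite andbF.
    move=> _; have -> : pi - 3 * alpha < pi - 2 * alpha by lra.
    by rewrite -s1_reflect; apply: s1_pi; ring.
  (* The branch below the centre pi - 2 alpha is written as the upper branch at the reflected point,
     which makes the symmetry visible. *)
  have value z : pi - 3 * alpha < z < pi - alpha -> feresq (@Ordinal 4 1 isT) z =
      if z < pi - 2 * alpha then s1 (- z + 2 * pi - 4 * alpha) else s1 z.
    move=> /andP[z1 z2]; rewrite feresqE /= s1_reflect.
    have -> : 0 < z < pi by apply/andP; split; lra.
    have -> : z < pi - 3 * alpha = false by apply/negbTE; rewrite -leNgt ltW.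
    by rewrite z2.
  have cond : (pi - 3 * alpha < - y + 2 * pi - 4 * alpha < pi - alpha) =
      (pi - 3 * alpha < y < pi - alpha).
    by apply: eq_cond => /andP[? ?]; apply/andP; split; lra.
  case: (boolP (pi - 3 * alpha < y < pi - alpha)) => [hy|/negbTE hy]; last first.
    by rewrite !zero// cond.
  rewrite !value ?cond//.
  have -> : - (- y + 2 * pi - 4 * alpha) + 2 * pi - 4 * alpha = y by ring.
  have -> : (- y + 2 * pi - 4 * alpha < pi - 2 * alpha) = (pi - 2 * alpha < y).
    by apply: eq_cond => ?; lra.
  by case: ltgtP => // e; congr s1; lra.
have H3 y : feresq (@Ordinal 4 3 isT) (- y + 4 * alpha) = feresq (@Ordinal 4 3 isT) y.
  have zero z : alpha < z < 3 * alpha = false -> feresq (@Ordinal 4 3 isT) z = 0.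
    rewrite feresqE /=; case: ifP => // _.
    case: (ltgtP z alpha) => [//|z1|->] /=.
      have -> : z < 2 * alpha = (z < 2 * alpha) && (z < 3 * alpha).
        by apply: eq_cond => [?|/andP[]//]; apply/andP; split; lra.
      by move=> ->; rewrite andbF.
    move=> _; have -> : alpha < 2 * alpha by lra.
    exact: s3_pi.
  have value z : alpha < z < 3 * alpha -> feresq (@Ordinal 4 3 isT) z =
      if z < 2 * alpha then s3 z else s3 (- z + 4 * alpha).
    move=> /andP[z1 z2]; rewrite feresqE /= s3_reflect.
    have -> : 0 < z < pi by apply/andP; split; lra.
    have -> : z < alpha = false by apply/negbTE; rewrite -leNgt ltW.
    by rewrite z2.
  have cond : (alpha < - y + 4 * alpha < 3 * alpha) = (alpha < y < 3 * alpha).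
    by apply: eq_cond => /andP[? ?]; apply/andP; split; lra.
  case: (boolP (alpha < y < 3 * alpha)) => [hy|/negbTE hy]; last first.
    by rewrite !zero// cond.
  rewrite !value ?cond//.
  have -> : - (- y + 4 * alpha) + 4 * alpha = y by ring.
  have -> : (- y + 4 * alpha < 2 * alpha) = (2 * alpha < y).
    by apply: eq_cond => ?; lra.
  by case: ltgtP => // e; congr s3; lra.
case: i => [[|[|[|[|]]]] // i4] /=; rewrite /feresT /feresinv /=.
- by rewrite (_ : Ordinal i4 = @Ordinal 4 0 isT) ?H0//; exact: val_inj.
- by rewrite (_ : Ordinal i4 = @Ordinal 4 1 isT) ?H1//; exact: val_inj.
- rewrite H0 (_ : Ordinal i4 = @Ordinal 4 2 isT); last exact: val_inj.
  by congr feresq; ring.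
- by rewrite (_ : Ordinal i4 = @Ordinal 4 3 isT) ?H3//; exact: val_inj.
Qed.

(** The differences of sines in [q_2] and [q_4] are, by the reflection identities, single shifted
    sines whose argument lies in [0, pi]. *)
Lemma feresq_ge0 i x : 0 <= feresq i x.
Proof.
have [? ?] := andP halpha.
have s1_ge0 y : 0 <= y + alpha <= pi -> 0 <= s1 y.
  by move=> ?; rewrite divr_ge0 ?sin_ge0_pi// mulr_ge0// ltW.
have s3_ge0 y : 0 <= y - alpha <= pi -> 0 <= s3 y.
  by move=> ?; rewrite divr_ge0 ?sin_ge0_pi// mulr_ge0// ltW.
rewrite feresqE; case: ifP => // /andP[? ?]; case: i => [[|[|[|[|]]]] // i4] /=;
  repeat (case: ifP => [|/negbT]; rewrite -?leNgt => ? //; try lra);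
  rewrite -?s1_reflect -?s3_reflect;
  (apply: s1_ge0 || apply: s3_ge0 || apply: sin_ge0_pi);
  by apply/andP; split; lra.
Qed.

(** Since [s1 + s3 = sin] and the terms [sin (x - 2 * alpha)] and [sin (x + 2 * alpha)] cancel in
    pairs. The bound alpha < pi / 6 gives 3 alpha < pi - 3 alpha, so the two cancellations take
    place on disjoint intervals. *)
Lemma sum_feresq x : \sum_(i < 4) feresq i x = sinpos x.
Proof.
have [? ?] := andP halpha.
have s13 : s1 x + s3 x = sin x.
  by rewrite /s1 /s3 sinD sinB; field; rewrite gt_eqF.
rewrite /sinpos !big_ord_recl big_ord0 !feresqE /=.
case: ifP => [/andP[? ?]|_]; last by rewrite !addr0.
by repeat (case: ltP => ? //=; try lra).
Qed.

Let s1_gt0 y : 0 < y + alpha < pi -> 0 < s1 y.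
Proof. by move=> ?; rewrite divr_gt0 ?sin_gt0_pi// mulr_gt0. Qed.

Let s3_gt0 y : 0 < y - alpha < pi -> 0 < s3 y.
Proof. by move=> ?; rewrite divr_gt0 ?sin_gt0_pi// mulr_gt0. Qed.

(** The intervals of positivity of the four weights decide which images can be compared: [T_1] and
    [T_3] on (2 alpha, pi - 2 alpha), [T_1] and [T_4] on (alpha, 3 alpha), [T_2] and [T_3] on (pi -
    3 alpha, pi - alpha). *)
Lemma feresq0_gt0 x : 0 < x < pi - 2 * alpha -> 0 < feresq (@Ordinal 4 0 isT) x.
Proof.
have [? ?] := andP halpha; move=> /andP[? ?].
rewrite feresqE; case: ifP => [_|/negP[]]/=; last by apply/andP; split; lra.
repeat (case: ifP => [|/negbT]; rewrite -?leNgt => ? //; try lra);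
  (apply: s1_gt0 || apply: s3_gt0 || apply: sin_gt0_pi); by apply/andP; split; lra.
Qed.

Lemma feresq1_gt0 x : pi - 3 * alpha < x < pi - alpha ->
  0 < feresq (@Ordinal 4 1 isT) x.
Proof.
have [? ?] := andP halpha; move=> /andP[? ?].
rewrite feresqE; case: ifP => [_|/negP[]]/=; last by apply/andP; split; lra.
repeat (case: ifP => [|/negbT]; rewrite -?leNgt => ? //; try lra);
  rewrite -?s1_reflect;
  (apply: s1_gt0 || apply: s3_gt0 || apply: sin_gt0_pi); by apply/andP; split; lra.
Qed.

Lemma feresq2_gt0 x : 2 * alpha < x < pi -> 0 < feresq (@Ordinal 4 2 isT) x.
Proof.
have [? ?] := andP halpha; move=> /andP[? ?].
rewrite feresqE; case: ifP => [_|/negP[]]/=; last by apply/andP; split; lra.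
repeat (case: ifP => [|/negbT]; rewrite -?leNgt => ? //; try lra);
  (apply: s1_gt0 || apply: s3_gt0 || apply: sin_gt0_pi); by apply/andP; split; lra.
Qed.

Lemma feresq3_gt0 x : alpha < x < 3 * alpha -> 0 < feresq (@Ordinal 4 3 isT) x.
Proof.
have [? ?] := andP halpha; move=> /andP[? ?].
rewrite feresqE; case: ifP => [_|/negP[]]/=; last by apply/andP; split; lra.
repeat (case: ifP => [|/negbT]; rewrite -?leNgt => ? //; try lra);
  rewrite -?s3_reflect;
  (apply: s1_gt0 || apply: s3_gt0 || apply: sin_gt0_pi); by apply/andP; split; lra.
Qed.

End feres_weights.

(** * Irrational rotations *)

Section irrational_rotation.
Context {R : realType}.
Implicit Types (x y e : R).

Let fpart x : R := x - (Num.floor x)%:~R.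

Let fpart_ge0 x : 0 <= fpart x.
Proof. by rewrite subr_ge0 floor_le. Qed.

Let fpart_lt1 x : fpart x < 1.
Proof. by rewrite ltrBlDl; have /andP[_] := floor_itv x; rewrite intrD. Qed.

(** Dirichlet's pigeonhole argument: among the [N + 1] fractional parts of [i * rho] two share one
    of [N] boxes of length [1 / N < e]. Their difference is not 0, as otherwise [rho] would be
    rational. *)
Lemma irrational_small_step (rho e : R) : irrational rho -> 0 < e ->
  exists n : nat, exists j : int, 0 < `|n%:R * rho + j%:~R| < e.
Proof.
move=> irr e0; pose N := Num.bound e^-1.
have N0 : (0 < N%:R :> R).
  by rewrite (lt_trans _ (archi_boundP _)) ?invr_gt0 ?invr_ge0 ?ltW.
have Ne : (N%:R^-1 < e :> R).
  by rewrite invf_plt ?posrE// archi_boundP// invr_ge0 ltW.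
pose f (i : 'I_N.+1) := Num.trunc (N%:R * fpart (i%:R * rho)).
have f_itv i : (f i)%:R <= N%:R * fpart (i%:R * rho) < (f i).+1%:R.
  by apply: truncn_itv; rewrite mulr_ge0// ltW.
have fN i : (f i < N)%N.
  have /andP[h _] := f_itv i; rewrite -(ltr_nat R); apply: le_lt_trans h _.
  by rewrite -[ltRHS]mulr1 ltr_pM2l.
have /injectivePn[i [j ij fij]] : ~~ injectiveb (fun i => Ordinal (fN i)).
  by apply/injectiveP => /leq_card; rewrite !card_ord ltnn.
wlog ltij : i j ij fij / (i < j)%N.
  move=> H; case: (ltngtP i j) => [ltij|ltji|/val_inj eij].
  - exact: (H i j).
  - by apply: (H j i) => //; rewrite eq_sym.
  - by rewrite eij eqxx in ij.
pose z := Num.floor (i%:R * rho) - Num.floor (j%:R * rho).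
exists (j - i)%N, z.
have E : (j - i)%:R * rho + z%:~R = fpart (j%:R * rho) - fpart (i%:R * rho).
  by rewrite natrB 1?ltnW// /z intrB /fpart; ring.
apply/andP; split.
  rewrite normr_gt0; apply/eqP => E0; apply: irr.
  have ji0 : (j - i)%:R != 0 :> R by rewrite pnatr_eq0 subn_eq0 -ltnNge.
  exists (- z%:~R / (j - i)%:R) => //.
  rewrite rmorphM rmorphN fmorphV /= ratr_int ratr_nat.
  by apply: (mulIf ji0); rewrite divfK// [RHS]mulrC; apply/eqP; rewrite eq_sym -addr_eq0 E0.
rewrite E; apply: lt_trans Ne.
have /andP[h1 h2] := f_itv i; have /andP[h3 h4] := f_itv j.
move: fij => /(congr1 val)/= fij; rewrite -fij in h3 h4.
rewrite -(ltr_pM2l N0) mulfV ?gt_eqF// -[X in X * _]gtr0_norm// -normrM mulrBr.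
move: h2 h4; rewrite -[(f i).+1]addn1 natrD => h2 h4.
rewrite ltr_norml; apply/andP; split; lra.
Qed.

(** The multiples of a small nonzero step [s] pass within [|s| < e] of every point on their side of
    0. *)
Lemma irrational_dense (rho y e : R) : irrational rho -> 0 < e ->
  exists n : nat, exists j : int, `|n%:R * rho + j%:~R - y| < e.
Proof.
move=> irr e0; have [m [l /andP[s0 se]]] := irrational_small_step irr e0.
set s := m%:R * rho + l%:~R in s0 se.
(* Only natural multiples of [rho] are allowed, so [y] is first moved by an integer to the side of 0
   given by the sign of [s]. *)
have [b [sb bs]] : exists b : int, 0 <= (y + b%:~R) / s /\ s != 0.
  have s_neq0 : s != 0 by rewrite -normr_gt0.
  case: (ltgtP s 0) => [sl0|sg0|/eqP]; last by rewrite (negbTE s_neq0).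
  - exists (- Num.floor y - 1); split => //.
    rewrite ler_ndivlMr// mul0r intrD intrN.
    by have /andP[_] := floor_itv y; rewrite intrD; lra.
  - exists (- Num.floor y); split => //.
    by rewrite ler_pdivlMr// mul0r intrN subr_ge0 floor_le.
pose t := Num.trunc ((y + b%:~R) / s).
have /andP[t1 t2] := truncn_itv sb.
exists (t * m)%N, (t%:Z * l - b).
have -> : (t * m)%:R * rho + (t%:Z * l - b)%:~R - y =
    - (((y + b%:~R) / s - t%:R) * s).
  by rewrite mulrBl divfK// natrM intrB intrM /s; ring.
rewrite normrN normrM; apply: le_lt_trans se.
rewrite ler_piMl//; move: t2; rewrite -natr1 -/t => t2.
by rewrite ger0_norm ?subr_ge0//; lra.
Qed.

End irrational_rotation.

(** * Asymptotic linearity *)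

Section vanishing.
Context {R : realType}.
Implicit Types u v w : nat -> R.

Definition vanishes u := u n @[n --> \oo] --> (0 : R).

Lemma vanishes_lin (a b : R) u v w : vanishes u -> vanishes v ->
  (forall n, w n = a * u n + b * v n) -> vanishes w.
Proof.
move=> u0 v0 /funext ->; rewrite /vanishes.
have -> : 0 = a * 0 + b * 0 :> R by ring.
by apply: cvgD; apply: cvgMr.
Qed.

Lemma vanishes_eq0 w : (forall n, w n = 0) -> vanishes w.
Proof. by move=> /funext ->; exact: cvg_cst. Qed.

Lemma vanishesP w :
  (forall e, 0 < e -> exists2 u, vanishes u & forall n, `|w n| <= `|u n| + e) ->
  vanishes w.
Proof.
move=> H; apply/cvgr0Pnorm_lt => e e0.
have [|u u0 wu] := H (e / 2); first by rewrite divr_gt0.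
have /cvgr0Pnorm_lt/(_ (e / 2)) := u0; rewrite divr_gt0// => /(_ isT).
apply: filterS => n un; apply: le_lt_trans (wu n) _; lra.
Qed.

End vanishing.

(** * Primitives asymptotically invariant under a translation and two reflections *)

Section asymptotic_linearity.
Context {R : realType} (alpha : R).
Hypothesis halpha : 0 < alpha < pi / 6.
Hypothesis hirr : irrational (alpha / pi).
Implicit Types (x y : R) (n : nat) (j : int).

(** Stands for the integral of [f_n] from 0 to [x]; the hypotheses are the invariances in integrated
    form. Their ranges of [x] are images of the intervals where two weights are positive: of
    [2 alpha, pi - 2 alpha] under [T_3], of [alpha, 3 alpha] under [T_1], of
    [pi - 3 alpha, pi - alpha] under [T_3]. *)
Variable Phi : nat -> R -> R.
Hypothesis Phi_slope : forall n x y, 0 <= x <= y -> y <= pi ->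
  0 <= Phi n y - Phi n x <= y - x.
Hypothesis Phi_shift : forall x, 0 <= x <= pi - 4 * alpha -> vanishes (fun n =>
  (Phi n (x + 4 * alpha) - Phi n x) - (Phi n (4 * alpha) - Phi n 0)).
Hypothesis Phi_left : forall x, 3 * alpha <= x <= 5 * alpha -> vanishes (fun n =>
  Phi n x + Phi n (6 * alpha - x) - 2 * Phi n (3 * alpha)).
Hypothesis Phi_right : forall x, pi - 5 * alpha <= x <= pi - 3 * alpha ->
  vanishes (fun n => Phi n x + Phi n (2 * pi - 6 * alpha - x)
                     - 2 * Phi n (pi - 3 * alpha)).

Let L := 4 * alpha.

Let L_gt0 : 0 < L. Proof. by have [? ?] := andP halpha; rewrite /L; lra. Qed.

Let idx (b x : R) : int := Num.floor ((x - b) / L).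

Let idxP b x : b <= x - L * (idx b x)%:~R < b + L.
Proof.
have /andP[] := floor_itv ((x - b) / L).
rewrite -/(idx b x) intrD ler_pdivlMr// ltr_pdivrMr// => h1 h2.
by apply/andP; split; lra.
Qed.

(** The base interval [alpha, 5 alpha] has length [L] and is symmetric about 3 alpha, so the left
    reflection acts inside it, where the extension below coincides with [Phi n]. *)
Let incr n := Phi n (5 * alpha) - Phi n alpha.

(* The extension of [Phi n], restricted to [alpha, 5 alpha], that satisfies
   [Psi n (x + L) = Psi n x + incr n]. *)
Let Psi n x := Phi n (x - L * (idx alpha x)%:~R) + incr n * (idx alpha x)%:~R.

Let PsiDz n x j : Psi n (x + L * j%:~R) = Psi n x + incr n * j%:~R.
Proof.
have e : idx alpha (x + L * j%:~R) = idx alpha x + j.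
  rewrite /idx; apply: floor_def.
  have -> : (x + L * j%:~R - alpha) / L = (x - alpha) / L + j%:~R.
    by field; rewrite gt_eqF.
  by have /andP[h1 h2] := floor_itv ((x - alpha) / L);
    rewrite !intrD in h2 *; apply/andP; split; lra.
rewrite /Psi e intrD mulrDr opprD addrA (addrAC (x + _)) mulrDr addrA.
by congr (Phi n _ + _ + _); ring.
Qed.

Let PsiD n x : Psi n (x + L) = Psi n x + incr n.
Proof. by rewrite -[L in LHS]mulr1 -[1]/(1%:~R) PsiDz mulr1. Qed.

Let Psi_mid n x : alpha <= x <= 5 * alpha -> Psi n x = Phi n x.
Proof.
move=> /andP[ax]; rewrite le_eqVlt => /predU1P[->|xa].
  have -> : 5 * alpha = alpha + L by rewrite /L; ring.
  rewrite PsiD {1}/Psi.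
  have -> : idx alpha alpha = 0 by rewrite /idx subrr mul0r floor0.
  rewrite !mulr0 subr0 addr0 /incr /L.
  by rewrite addrC subrK; congr Phi; ring.
rewrite /Psi; suff -> : idx alpha x = 0 by rewrite !mulr0 subr0 addr0.
rewrite /idx; apply: floor_def; rewrite add0r mulr0z mulr1z.
have [? ?] := andP halpha.
by rewrite ler_pdivlMr// ltr_pdivrMr// /L; apply/andP; split; lra.
Qed.

Let Phi_incr x : 0 <= x <= pi - L ->
  vanishes (fun n => Phi n (x + L) - Phi n x - incr n).
Proof.
move=> xL; have [? ?] := andP halpha.
have h : 0 <= alpha <= pi - 4 * alpha by apply/andP; split; lra.
apply: (vanishes_lin (a := 1) (b := -1) (Phi_shift xL) (Phi_shift h)) => n.
by rewrite /incr /L (_ : alpha + 4 * alpha = 5 * alpha); ring.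
Qed.

(** [Phi n] satisfies the periodicity relation only asymptotically, so every period between [x] and
    the base interval costs one vanishing error; the number of periods does not depend on [n]. *)
Let Psi_Phi x : 0 <= x <= pi -> vanishes (fun n => Psi n x - Phi n x).
Proof.
have [? ?] := andP halpha; rewrite -/L.
have small y : 0 <= y < alpha -> vanishes (fun n => Psi n y - Phi n y).
  move=> /andP[y0 ya].
  have h : 0 <= y <= pi - L by rewrite /L; apply/andP; split; lra.
  apply: (vanishes_lin (a := 1) (b := 0) (Phi_incr h) (Phi_incr h)) => n.
  have := PsiD n y; rewrite [LHS]Psi_mid; last by rewrite /L; apply/andP; split; lra.
  move=> ->; ring.
have [m] : exists m : nat, x < alpha + L * m%:R.
  exists (Num.bound (x / L)); have := unstable.ltr_bound (x / L).
  by rewrite ltr_pdivrMr//; lra.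
elim: m x => [|m IH] x xm /andP[x0 xpi].
  by apply: small; rewrite x0/=; move: xm; rewrite mulr0 addr0.
have [xa|ax] := ltP x alpha; first by apply: small; rewrite x0.
have [xa5|ax5] := leP x (5 * alpha).
  by apply: vanishes_eq0 => n; rewrite Psi_mid ?ax// subrr.
have xL : 0 <= x - L <= pi - L by rewrite /L; apply/andP; split; lra.
have xL' : 0 <= x - L <= pi by rewrite /L; apply/andP; split; lra.
have xLm : x - L < alpha + L * m%:R by move: xm; rewrite -natr1 mulrDr; lra.
apply: (vanishes_lin (a := 1) (b := -1) (IH _ xLm xL') (Phi_incr xL)) => n.
have := PsiD n (x - L); rewrite subrK => ->; ring.
Qed.

(** Moving [x] by [j] periods moves [c - x] by [-j] periods, and the two multiples of [incr n]
    cancel; hence one period suffices. *)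
Let Psi_reflect (C : nat -> R) c b : 
  (forall x, b <= x < b + L -> vanishes (fun n => Psi n x + Psi n (c - x) - C n)) ->
  forall x, vanishes (fun n => Psi n x + Psi n (c - x) - C n).
Proof.
move=> H x; pose j := idx b x; pose r := x - L * j%:~R.
have Hr := H r (idxP b x).
apply: (vanishes_lin (a := 1) (b := 0) Hr Hr) => n.
have -> : x = r + L * j%:~R by rewrite /r subrK.
have -> : c - (r + L * j%:~R) = (c - r) + L * (- j)%:~R by rewrite intrN; ring.
by rewrite !PsiDz intrN; ring.
Qed.

Let Psi_left x : vanishes (fun n =>
  Psi n x + Psi n (6 * alpha - x) - 2 * Phi n (3 * alpha)).
Proof.
have [? ?] := andP halpha.
apply: (@Psi_reflect (fun n => 2 * Phi n (3 * alpha)) _ alpha) => {}x /andP[x1 x2].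
rewrite /L in x2.
have [x3|x3] := leP (3 * alpha) x.
  have h : 3 * alpha <= x <= 5 * alpha by apply/andP; split; lra.
  apply: (vanishes_lin (a := 1) (b := 0) (Phi_left h) (Phi_left h)) => n.
  by rewrite !Psi_mid; [ring| |]; apply/andP; split; lra.
have h : 3 * alpha <= 6 * alpha - x <= 5 * alpha by apply/andP; split; lra.
apply: (vanishes_lin (a := 1) (b := 0) (Phi_left h) (Phi_left h)) => n.
rewrite (_ : 6 * alpha - (6 * alpha - x) = x); last by ring.
by rewrite !Psi_mid; [ring| |]; apply/andP; split; lra.
Qed.

Let Psi_right x : vanishes (fun n =>
  Psi n x + Psi n (2 * pi - 6 * alpha - x) - 2 * Phi n (pi - 3 * alpha)).
Proof.
have [? ?] := andP halpha.
apply: (@Psi_reflect (fun n => 2 * Phi n (pi - 3 * alpha)) _ (pi - 5 * alpha))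
  => {}x /andP[x1 x2].
rewrite /L in x2.
set x' := 2 * pi - 6 * alpha - x.
have h1 : 0 <= x <= pi by apply/andP; split; lra.
have h2 : 0 <= x' <= pi by rewrite /x'; apply/andP; split; lra.
(* The period around pi - 3 alpha need not lie in the base interval, so [Psi] and [Phi] agree there
   only up to a vanishing error. *)
have V := vanishes_lin (a := 1) (b := 1) (Psi_Phi h1) (Psi_Phi h2) (fun=> erefl).
have [x3|x3] := leP x (pi - 3 * alpha).
  have h : pi - 5 * alpha <= x <= pi - 3 * alpha by apply/andP; split; lra.
  by apply: (vanishes_lin (a := 1) (b := 1) V (Phi_right h)) => n; rewrite -/x'; ring.
have h : pi - 5 * alpha <= x' <= pi - 3 * alpha.
  by rewrite /x'; apply/andP; split; lra.
apply: (vanishes_lin (a := 1) (b := 1) V (Phi_right h)) => n.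
by rewrite /x' (_ : 2 * pi - 6 * alpha - (2 * pi - 6 * alpha - x) = x); ring.
Qed.

Let slope n := incr n / L.

(** The [L]-periodic part of [Psi n]. Asymptotic linearity means that it becomes constant. *)
Let D n x := Psi n x - x * slope n.

Let DDz n x j : D n (x + L * j%:~R) = D n x.
Proof. by rewrite /D PsiDz /slope; field; rewrite gt_eqF. Qed.

(** The drift of [D n] under the translation by 2 pi: the difference of the two reflection
    constants, three periods for 12 alpha = 3 [L], and the linear part removed in [D]. That it is
    independent of the point is what makes iteration useful. *)
Let delta n :=
  2 * Phi n (pi - 3 * alpha) - 2 * Phi n (3 * alpha) + 3 * incr n
  - 2 * pi * slope n.

(* Composing the two reflections gives the translation by 2 pi - 3 L. *)
Let D_shift x : vanishes (fun n => D n (x + 2 * pi) - D n x - delta n).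
Proof.
apply: (vanishes_lin (a := 1) (b := -1) (Psi_right (6 * alpha - x)) (Psi_left x)).
move=> n; rewrite /D /delta.
have -> : x + 2 * pi = 2 * pi - 6 * alpha - (6 * alpha - x) + L * (3 : int)%:~R.
  by rewrite /L; ring.
rewrite PsiDz {1}/L; ring.
Qed.

Let D_shiftMn x m : vanishes (fun n => D n (x + 2 * pi * m%:R) - D n x - m%:R * delta n).
Proof.
elim: m => [|m IH].
  by apply: vanishes_eq0 => n; rewrite mulr0 addr0 mul0r; ring.
apply: (vanishes_lin (a := 1) (b := 1) IH (D_shift (x + 2 * pi * m%:R))) => n.
have -> : x + 2 * pi * m%:R + 2 * pi = x + 2 * pi * m.+1%:R.
  by rewrite -natr1; ring.
by rewrite -natr1; ring.
Qed.

Let incr_itv n : 0 <= incr n <= L.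
Proof.
have [? ?] := andP halpha.
have := @Phi_slope n alpha (5 * alpha).
have -> : 5 * alpha - alpha = L by rewrite /L; ring.
by apply; [apply/andP; split|]; lra.
Qed.

Let slope_itv n : 0 <= slope n <= 1.
Proof.
have /andP[? ?] := incr_itv n.
by rewrite /slope ler_pdivrMr// mul1r divr_ge0// ltW.
Qed.

(** [Phi n] and the subtracted linear function both have slopes in [0, 1]. *)
Let D_lip n x y : alpha <= x <= 5 * alpha -> alpha <= y <= 5 * alpha ->
  `|D n x - D n y| <= `|x - y|.
Proof.
have [? ?] := andP halpha.
wlog xy : x y / x <= y.
  move=> H; have [xy|/ltW yx] := leP x y; first exact: H.
  by move=> hx hy; rewrite distrC [leRHS]distrC; exact: H.
move=> hx hy; rewrite /D !Psi_mid//.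
case/andP : hx hy => x1 x2 /andP[y1 y2].
have /andP[h1 h2] : 0 <= Phi n y - Phi n x <= y - x.
  by apply: Phi_slope; [apply/andP; split|]; lra.
have /andP[s0 s1] := slope_itv n.
have s2 : 0 <= (y - x) * slope n <= y - x.
  by rewrite mulr_ge0 ?subr_ge0//= ler_piMr// subr_ge0.
have [s3 s4] := andP s2.
rewrite distrC [leRHS]ler0_norm ?subr_le0// ler_norml.
by apply/andP; split; lra.
Qed.

Let D_bnd n x y : `|D n x - D n y| <= L.
Proof.
have [? ?] := andP halpha.
have mid z : alpha <= z - L * (idx alpha z)%:~R <= 5 * alpha.
  have /andP[h1 h2] := idxP alpha z; rewrite h1/= ltW//.
  by apply: lt_le_trans h2 _; rewrite /L; lra.
have e z : D n z = D n (z - L * (idx alpha z)%:~R).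
  by rewrite -(DDz n (z - _) (idx alpha z)) subrK.
rewrite (e x) (e y); apply: le_trans (D_lip _ (mid x) (mid y)) _.
have /andP[x1 x2] := mid x; have /andP[y1 y2] := mid y.
by rewrite ler_norml /L in x1 x2 y1 y2 *; apply/andP; split; lra.
Qed.

(** Up to a vanishing error, [m * delta n] is a difference of two values of [D n], hence bounded by
    [L]. With [m] at least [L / e] this bounds [delta n] by [e] up to a vanishing error. *)
Let delta_vanishes : vanishes delta.
Proof.
apply: vanishesP => e e0; pose m := (Num.bound (L / e)).+1.
have m0 : 0 < m%:R :> R by [].
have Lm : L <= e * m%:R.
  have := unstable.ltr_bound (L / e); rewrite ltr_pdivrMr// => h.
  by rewrite /m -natr1; lra.
exists (fun n => m%:R^-1 * (D n (0 + 2 * pi * m%:R) - D n 0 - m%:R * delta n)).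
  have h := D_shiftMn 0 m.
  by apply: (vanishes_lin (a := m%:R^-1) (b := 0) h h) => n; ring.
move=> n /=; set u := D n _ - D n 0.
have ub : `|u| <= L by exact: D_bnd.
set v := _ * (u - _).
have -> : delta n = m%:R^-1 * u - v by rewrite /v; field; rewrite gt_eqF.
apply: le_trans (ler_normB _ _) _; rewrite [leRHS]addrC lerD2r normrM gtr0_norm ?invr_gt0//.
rewrite mulrC ler_pdivrMr//; exact: le_trans ub _.
Qed.

Let D_shift0 x m : vanishes (fun n => D n (x + 2 * pi * m%:R) - D n x).
Proof.
apply: (vanishes_lin (a := 1) (b := m%:R) (D_shiftMn x m) delta_vanishes).
by move=> n; ring.
Qed.

(** By density, some [z = x + 2 * pi * m + L * j] is close to [y]. Passing from [x] to [z] costs a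
    vanishing error for the fixed [m] and nothing for [j]; passing from [z] to [y] costs at most [e]
    by the Lipschitz bound. *)
Let D_const x y : alpha < y < 5 * alpha -> vanishes (fun n => D n x - D n y).
Proof.
move=> /andP[y1 y2]; have [? ?] := andP halpha.
have irr' : irrational (2 * pi / L).
  move=> [q _ qE]; apply: hirr; exists (2 * q)^-1 => //.
  rewrite fmorphV rmorphM /= qE ratr_nat /L; field.
  by rewrite !gt_eqF//; lra.
apply: vanishesP => e e0.
(* The last two terms keep [z] inside the base interval, where the Lipschitz bound holds. *)
pose e' := Num.min e (Num.min (y - alpha) (5 * alpha - y)).
have e'0 : 0 < e' by rewrite !lt_min e0 !subr_gt0 y1.
have [m [j]] := irrational_dense ((y - x) / L) irr' (divr_gt0 e'0 L_gt0).
rewrite ltr_pdivlMr// -[X in _ * X](gtr0_norm L_gt0) -normrM => H.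
pose z := x + 2 * pi * m%:R + L * j%:~R.
have {}H : `|z - y| < e'.
  apply: le_lt_trans H; rewrite le_eqVlt; apply/orP; left; apply/eqP.
  by congr `| _ |; rewrite /z; field; rewrite gt_eqF.
move: H; rewrite !lt_min => /and3P[H1 H2 H3].
exists (fun n => D n (x + 2 * pi * m%:R) - D n x); first exact: D_shift0.
move=> n; have -> : D n x - D n y =
    - (D n (x + 2 * pi * m%:R) - D n x) + (D n z - D n y).
  by rewrite /z DDz; ring.
apply: le_trans (ler_normD _ _) _; rewrite normrN lerD2l.
apply: le_trans (ltW H1); move: H2 H3; rewrite !ltr_norml => /andP[? ?] /andP[? ?].
by apply: D_lip; apply/andP; split; lra.
Qed.

Lemma asymptotically_linear x y : 0 <= x <= pi -> 0 <= y <= pi ->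
  vanishes (fun n => Phi n y - Phi n x
    - (y - x) * ((Phi n (5 * alpha) - Phi n alpha) / (4 * alpha))).
Proof.
move=> hx hy; have [? ?] := andP halpha.
(* An interior point of the base interval, with which the values of [D n] at [x] and [y] are both
   compared. *)
have h : alpha < 2 * alpha < 5 * alpha by apply/andP; split; lra.
have V1 := vanishes_lin (a := 1) (b := -1) (D_const y h) (D_const x h) (fun=> erefl).
have V2 := vanishes_lin (a := 1) (b := -1) (Psi_Phi hx) (Psi_Phi hy) (fun=> erefl).
apply: (vanishes_lin (a := 1) (b := 1) V1 V2) => n.
by rewrite -/L -/(incr n) -/(slope n) /D; ring.
Qed.

End asymptotic_linearity.

(** * Uniformly bounded sequences *)

Section bounded_sequences.
Import HBSimple.
Context {d} {T : measurableType d} {R : realType}.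
Variables (mu : {measure set T -> \bar R}) (D : set T).
Hypotheses (mD : measurable D) (muD : (mu D < +oo)%E).
Implicit Types (E : set T) (f h : T -> R).

Lemma bounded_integrable f c : measurable_fun D f ->
  (forall x, D x -> `|f x| <= c) -> mu.-integrable D (EFin \o f).
Proof.
move=> mf fc; apply: measurable_bounded_integrable => //.
exists c; split; first exact: num_real.
by move=> x cx y Dy; exact: le_trans (fc y Dy) (ltW cx).
Qed.

Let cst_int c : mu.-integrable D (EFin \o cst c).
Proof. by apply: (@bounded_integrable _ `|c|) => //; exact: measurable_cst. Qed.

Variable phi : nat -> T -> R.
Hypothesis mphi : forall n, measurable_fun D (phi n).
Hypothesis phi_le1 : forall n x, D x -> `|phi n x| <= 1.

Let phi_int n : mu.-integrable D (EFin \o phi n).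
Proof. by apply: bounded_integrable (phi_le1 n). Qed.

Let phi_intI n E : measurable E -> mu.-integrable (D `&` E) (EFin \o phi n).
Proof.
by move=> mE; apply: integrableS (phi_int n) => //; exact: measurableI.
Qed.

Let mulphi_int h n : mu.-integrable D (EFin \o h) ->
  mu.-integrable D (EFin \o (fun x => h x * phi n x)).
Proof.
move=> hi; have := integrableMl mD hi (mphi n); rewrite /comp/=.
apply; exists 1; split; first exact: num_real.
by move=> x x1 y Dy; exact: le_trans (phi_le1 n Dy) (ltW x1).
Qed.

Let H : set (set T) := [set E | measurable E /\
  vanishes (fun n => \int[mu]_(x in D `&` E) phi n x)].

Let RintegralSD n A B : measurable A -> measurable B -> B `<=` A ->
  \int[mu]_(x in D `&` A) phi n x =
  \int[mu]_(x in D `&` B) phi n x + \int[mu]_(x in D `&` (A `\` B)) phi n x.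
Proof.
move=> mA mB BA; have e : D `&` A = (D `&` B) `|` (D `&` (A `\` B)).
  by rewrite -setIUr setDUK.
rewrite {1}e Rintegral_setU//.
- exact: measurableI.
- by apply: measurableI => //; exact: measurableD.
- by rewrite -e; exact: phi_intI.
- apply/disj_setPS => x [[_ Bx] [_ [_]]]; exact.
Qed.

(** For increasing unions, the part of the union beyond [F N] has small measure by continuity from
    above, and as [|phi n| <= 1] its contribution is small uniformly in [n]. *)
Let lambdaH : vanishes (fun n => \int[mu]_(x in D) phi n x) -> lambda_system setT H.
Proof.
move=> HT; split => //.
- by split => //; rewrite setIT.
- move=> A B BA [mA hA] [mB hB]; split; first exact: measurableD.
  apply: (vanishes_lin (a := 1) (b := -1) hA hB) => n.
  by rewrite (RintegralSD n mA mB BA); ring.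
- move=> F ndF HF; have mF i : measurable (F i) by case: (HF i).
  have mU : measurable (\bigcup_i F i) by exact: bigcup_measurable.
  split => //; apply: vanishesP => e e0.
  have : mu (D `&` (\bigcup_i F i `\` F n)) @[n --> \oo] --> 0%E.
    have -> : 0%E = mu (\bigcap_n (D `&` (\bigcup_i F i `\` F n))).
      rewrite (_ : \bigcap_n _ = set0) ?measure0// -subset0 => x xI.
      have [_ [[i _ Fix] _]] := xI 0%N I.
      by have [_ [_]] := xI i I; apply.
    apply: nonincreasing_cvg_mu.
    - by apply: le_lt_trans muD; apply: le_measure; rewrite ?inE//;
        apply: measurableI => //; exact: measurableD.
    - by move=> i; apply: measurableI => //; exact: measurableD.
    - apply: bigcap_measurable => // i _.
      by apply: measurableI => //; exact: measurableD.
    - move=> i j ij; apply/subsetPset; apply: setIS; apply: setDS.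
      exact/subsetPset/ndF.
  move=> /fine_cvgP[_ /cvgr0Pnorm_lt/(_ e e0)][N _ /(_ N (leqnn N))] /= Ne.
  exists (fun n => \int[mu]_(x in D `&` F N) phi n x); first by case: (HF N).
  move=> n; rewrite (RintegralSD n mU (mF N)); last exact: bigcup_sup.
  apply: le_trans (ler_normD _ _) _; rewrite lerD2l.
  have mDF : measurable (D `&` (\bigcup_i F i `\` F N)).
    by apply: measurableI => //; exact: measurableD.
  apply: le_trans (le_normr_Rintegral _ _) _ => //.
    by apply: phi_intI; exact: measurableD.
  apply: le_trans (ltW Ne); apply: le_trans (ler_norm _).
  rewrite -[leRHS]mul1r -Rintegral_cst//; apply: le_Rintegral => //.
  - by apply: integrable_norm; apply: phi_intI; exact: measurableD.
  - exact: (integrableS mD mDF (@subIsetl _ _ _) (cst_int 1)).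
  - by move=> x [Dx _]; exact: phi_le1.
Qed.

(** Dynkin's pi-lambda theorem for the class [H]. *)
Lemma vanishes_Rintegral_set (G : set (set T)) : measurable = <<s G >> ->
  setI_closed G -> vanishes (fun n => \int[mu]_(x in D) phi n x) ->
  (forall E, G E -> vanishes (fun n => \int[mu]_(x in D `&` E) phi n x)) ->
  forall E, measurable E -> vanishes (fun n => \int[mu]_(x in D `&` E) phi n x).
Proof.
move=> mG GI VT VG E mE; suff [] : H E by [].
apply: (lambda_system_subset GI (lambdaH VT)) => //.
- move=> A GA; split; last exact: VG.
  by rewrite mG; apply: sub_sigma_algebra.
- by rewrite -mG.
Qed.

(** Simple functions approximate [h] in L^1, and since [|phi n| <= 1] the error is the same for all
    [n]. *)
Lemma vanishes_Rintegral_integrable h : mu.-integrable D (EFin \o h) ->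
  (forall E, measurable E -> vanishes (fun n => \int[mu]_(x in D `&` E) phi n x)) ->
  vanishes (fun n => \int[mu]_(x in D) (h x * phi n x)).
Proof.
move=> hi HE; apply: vanishesP => e e0.
have [g [gi _]] := approximation_sfun_integrable mD hi.
move=> /fine_cvgP[_ /cvgr0Pnorm_lt/(_ e e0)][N _ /(_ N (leqnn N))] /= Ne.
exists (fun n => \int[mu]_(x in D) (g N x * phi n x)); last first.
  move=> n.
  have -> : \int[mu]_(x in D) (h x * phi n x) =
      \int[mu]_(x in D) (g N x * phi n x) +
      \int[mu]_(x in D) ((h x - g N x) * phi n x).
    rewrite -RintegralD//; last 2 first.
    - exact: mulphi_int.
    - apply: (@mulphi_int (fun x => h x - g N x)).
      exact: (integrableB mD hi (gi N)).
    by apply: eq_Rintegral => x _; rewrite -mulrDl addrC subrK.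
  apply: le_trans (ler_normD _ _) _; rewrite lerD2l.
  have di : mu.-integrable D (EFin \o (fun x => h x - g N x)).
    exact: (integrableB mD hi (gi N)).
  have dpi := mulphi_int n di.
  apply: le_trans (le_normr_Rintegral mD dpi) _.
  apply: le_trans (ltW Ne); apply: le_trans (ler_norm _).
  apply: le_Rintegral => //.
  - exact: integrable_norm.
  - exact: (integrable_norm di).
  - by move=> x Dx; rewrite normrM ler_piMr// phi_le1.
(* The simple function as a sum over a list of its values, so that induction on the list reduces it
   to indicators. *)
pose g' (s : seq R) x := \sum_(y <- s) y * \1_(g N @^-1` [set y]) x.
suff V s : vanishes (fun n => \int[mu]_(x in D) (g' s x * phi n x)).
  have -> : g N = g' (finmap.enum_fset (fset_set (range (g N)))) :> (T -> R).
    by apply/funext => x; rewrite fimfunE fsbig_finite.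
  exact: V.
have g'i t : mu.-integrable D (EFin \o g' t).
  apply: (@bounded_integrable _ (\sum_(y <- t) `|y|)).
    by apply: measurable_sum => y; apply: measurable_funM.
  move=> x _; apply: le_trans (ler_norm_sum _ _ _) _.
  apply: ler_sum => y _; rewrite normrM ler_piMr// indicE.
  by case: (_ \in _); rewrite ?normr1 ?normr0.
elim: s => [|y s IH].
  apply: vanishes_eq0 => n; rewrite (@eq_Rintegral _ _ _ _ _ (cst 0)).
    by rewrite Rintegral_cst// mul0r.
  by move=> x _; rewrite /g' big_nil mul0r.
have mgy : measurable (g N @^-1` [set y]) by exact: measurable_funPTI.
have E1 n : \int[mu]_(x in D `&` g N @^-1` [set y]) phi n x =
    \int[mu]_(x in D) (\1_(g N @^-1` [set y]) x * phi n x).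
  rewrite Rintegral_mkcondr; apply: eq_Rintegral => x _.
  by rewrite patchE indicE; case: (_ \in _); rewrite ?mul1r ?mul0r.
have ind_int : mu.-integrable D (EFin \o (\1_(g N @^-1` [set y]) : T -> R)).
  apply: (@bounded_integrable _ 1) => [|x _].
    exact: measurable_indic.
  by rewrite indicE; case: (_ \in _); rewrite ?normr1 ?normr0.
have yind := mulphi_int _ ind_int.
apply: (vanishes_lin (a := y) (b := 1) (HE _ mgy) IH) => n.
rewrite E1 -RintegralZl// mul1r -RintegralD//; last 2 first.
- exact: (integrableZl mD y (yind n)).
- exact: mulphi_int.
by apply: eq_Rintegral => x _; rewrite /g' big_cons mulrDl mulrA.
Qed.

(** [w] has no positive lower bound, but the set [A k] where it is below [del = 1 / (k + 1)] has
    small measure. Off this set either [|phi n| <= del], or [|phi n| <= del^-2 * w * phi n ^ 2];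
    integrating the sum of the three bounds gives the claim. *)
Lemma vanishes_weighted (w : T -> R) : measurable_fun D w ->
  (forall x, D x -> 0 < w x <= 1) ->
  vanishes (fun n => \int[mu]_(x in D) (w x * phi n x ^+ 2)) ->
  vanishes (fun n => \int[mu]_(x in D) `|phi n x|).
Proof.
move=> mw w01 Vw; apply: vanishesP => e e0.
pose A k := D `&` w @^-1` `]-oo, (k.+1%:R^-1 : R)[.
have mA k : measurable (A k) by exact: (mw mD).
have muA : (mu \o A) k @[k --> \oo] --> 0%E.
  have -> : 0%E = mu (\bigcap_k A k).
    rewrite (_ : \bigcap_n _ = set0) ?measure0// -subset0 => x xI.
    have [Dx _] := xI 0%N I; have /andP[wx _] := w01 x Dx.
    have [_ /=] := xI (Num.bound (w x)^-1) I; rewrite in_itv/= ltNge => /negP; apply.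
    rewrite invf_ple ?posrE//; apply: ltW.
    by apply: lt_trans (unstable.ltr_bound _) _; rewrite ltr_nat.
  apply: nonincreasing_cvg_mu => //.
  - by apply: le_lt_trans muD; apply: le_measure; rewrite ?inE//; exact: subIsetl.
  - exact: bigcap_measurable.
  - move=> i j ij; apply/subsetPset => x [Dx]; rewrite /= !in_itv/= => wx; split => //.
    by rewrite /= in_itv/=; apply: lt_le_trans wx _; rewrite lef_pV2 ?posrE// ler_nat.
have : fine (mu (A k)) + k.+1%:R^-1 * fine (mu D) @[k --> \oo] --> (0 : R).
  rewrite -[X in _ --> X]addr0; apply: cvgD; first by case/fine_cvgP: muA.
  rewrite -[X in _ --> X](mul0r (fine (mu D))); apply: cvgMl; exact: cvg_harmonic.
move=> /cvgr0Pnorm_lt/(_ e e0)[k _ /(_ k (leqnn k))] /= ke.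
set del := k.+1%:R^-1 in ke.
have del0 : 0 < del by rewrite invr_gt0.
have wphi_int n : mu.-integrable D (EFin \o (fun x => w x * phi n x ^+ 2)).
  apply: (@bounded_integrable _ 1) => [|x Dx].
    by apply: measurable_funM => //; exact: measurable_funX.
  have /andP[w0 w1] := w01 x Dx.
  by rewrite normrM normrX (gtr0_norm w0) mulr_ile1// ?exprn_ile1 ?phi_le1// ltW.
have ind_int : mu.-integrable D (EFin \o (\1_(A k) : T -> R)).
  apply: (@bounded_integrable _ 1) => [|x _]; first exact: measurable_indic.
  by rewrite indicE; case: (_ \in _); rewrite ?normr1 ?normr0.
exists (fun n => del^-1 ^+ 2 * \int[mu]_(x in D) (w x * phi n x ^+ 2)).
  by apply: (vanishes_lin (a := del^-1 ^+ 2) (b := 0) Vw Vw) => n; ring.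
move=> n; rewrite ger0_norm; last by apply: Rintegral_ge0 => x _.
apply: le_trans (_ : _ <= \int[mu]_(x in D)
    ((\1_(A k) x + del) + del^-1 ^+ 2 * (w x * phi n x ^+ 2))) _.
  apply: le_Rintegral => //.
  - exact: (integrable_norm (phi_int n)).
  - exact: (integrableD mD (integrableD mD ind_int (cst_int del))
      (integrableZl mD (del^-1 ^+ 2) (wphi_int n))).
  move=> x Dx; have /andP[w0 w1] := w01 x Dx; rewrite indicE.
  have w0' := ltW w0; have del0' := ltW del0.
  have X0 : 0 <= del^-1 ^+ 2 * (w x * phi n x ^+ 2).
    by apply: mulr_ge0 (sqr_ge0 _) (mulr_ge0 _ (sqr_ge0 _)).
  have [xA|xA] := boolP (x \in A k).
    rewrite -addrA ler_wpDr// ?phi_le1//.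
    by rewrite addr_ge0.
  have wdel : del <= w x.
    rewrite leNgt; apply/negP => wd; move/negP: xA; apply.
    by rewrite inE; split => //=; rewrite in_itv.
  rewrite /= add0r; have [hl|hl] := leP `|phi n x| del.
    by rewrite ler_wpDr.
  rewrite ler_wpDl// -[phi n x ^+ 2]real_normK ?num_real//.
  rewrite [leRHS](_ : _ = (w x / del) * (`|phi n x| / del) * `|phi n x|).
    by rewrite ler_peMl// mulr_ege1// ler_pdivlMr// mul1r// ltW.
  by ring.
rewrite RintegralD//; last 2 first.
- exact: (integrableD mD ind_int (cst_int del)).
- exact: (integrableZl mD (del^-1 ^+ 2) (wphi_int n)).
rewrite RintegralD//; last exact: cst_int.
rewrite RintegralZl// Rintegral_cst// addrC lerD//.
  by rewrite ler_norm.
apply: le_trans (ltW ke); apply: le_trans (ler_norm _); rewrite lerD2r.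
by rewrite /Rintegral integral_indic// setIC (_ : D `&` A k = A k)// /A setIA setIid.
Qed.

End bounded_sequences.

(** * The Markov operator *)

Section line_isometries.
Context {R : realType}.
Local Notation leb := (@lebesgue_measure R).
Implicit Types (t : R) (A D : set R) (f : R -> \bar R).

Lemma measurable_inv : measurable_fun [set: R] (@GRing.inv R).
Proof.
rewrite -(setUv [set 0 : R]); apply/measurable_funU => //.
  exact: measurableC.
split; first exact: measurable_fun_set1.
apply: open_continuous_measurable_fun.
  apply: closed_openC; apply: accessible_closed_set1; apply: hausdorff_accessible.
  exact: Rhausdorff.
move=> x; rewrite inE => /eqP x0; exact: inv_continuous.
Qed.

(** By uniqueness of the measure that gives half-open intervals their length. *)
Lemma lebesgue_measure_shift t A : measurable A ->
  leb ((fun x => x + t) @^-1` A) = leb A.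
Proof.
move=> mA; have mt : measurable_fun [set: R] (fun x : R => x + t : measurableTypeR R).
  exact: measurable_funD.
pose m := pushforward leb (fun x : R => x + t : measurableTypeR R).
apply/esym; apply: (@lebesgue_measure_unique R m) => // _ [[a b]] _ <-.
transitivity (leb `]a - t, b - t]%classic); last first.
  congr (leb _).
  by apply/seteqP; split => x; rewrite /= !in_itv/= ltrBlDr lerBrDr.
rewrite !lebesgue_measure_itv/= !lte_fin ltrD2r.
by case: ifP => // _; rewrite -!EFinB; congr EFin; ring.
Qed.

Lemma lebesgue_measure_reflect t A : measurable A ->
  leb ((fun x => - x + t) @^-1` A) = leb A.
Proof.
move=> mA; rewrite -[RHS](lebesgue_measure_shift t mA).
rewrite -[RHS](lebesgue_measureN (A := (fun x => x + t) @^-1` A))//.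
rewrite -[X in measurable X]setTI; apply: measurable_funD => //.
Qed.

Lemma ge0_integral_isometry (T : R -> R) D f : measurable_fun setT T ->
  (forall A, measurable A -> leb (T @^-1` A) = leb A) ->
  measurable D -> measurable_fun D f -> (forall x, D x -> (0 <= f x)%E) ->
  (\int[leb]_(x in T @^-1` D) f (T x) = \int[leb]_(x in D) f x)%E.
Proof.
move=> mT Tleb mD mf f0.
have mT' : measurable_fun setT (T : R -> measurableTypeR R) by [].
transitivity (\int[pushforward leb (T : R -> measurableTypeR R)]_(y in D) f y)%E.
  by rewrite ge0_integral_pushforward// => x; rewrite inE; exact: f0.
by apply: eq_measure_integral => A mA _; exact: Tleb.
Qed.

End line_isometries.

(** * The operator [P], its symmetry and the decay of its energy *)

Section feres_operator.
Context {R : realType} (alpha : R).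
Hypothesis halpha : 0 < alpha < pi / 6.
Local Notation leb := (@lebesgue_measure R).
Local Notation T := (feresT alpha).
Local Notation q := (feresq alpha).
Implicit Types (f h : R -> R) (i j : 'I_4) (x : R).

Lemma measurable_feresT i : measurable_fun [set: R] (T i).
Proof.
case: i => [[|[|[|[|]]]] // i4]; rewrite /feresT /=;
  repeat first [exact: measurable_cst|exact: measurable_id
               |apply: measurable_funD|apply: measurable_funN].
Qed.

Lemma lebesgue_measure_feresT i A : measurable A -> leb (T i @^-1` A) = leb A.
Proof.
move=> mA; case: i => [[|[|[|[|]]]] // i4]; rewrite /feresT /=.
- exact: lebesgue_measure_shift.
- rewrite -[RHS](lebesgue_measure_reflect (2 * pi - 4 * alpha) mA).
  by congr (leb _); apply/seteqP; split => x; rewrite /= addrA.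
- exact: lebesgue_measure_shift.
- exact: lebesgue_measure_reflect.
Qed.

Lemma measurable_sinpos : measurable_fun [set: R] (@sinpos R).
Proof.
apply: measurable_fun_ifT => //.
  by apply: measurable_and; apply: measurable_fun_ltr.
by apply: continuous_measurable_fun; exact: continuous_sin.
Qed.

Lemma measurable_feresu a : measurable_fun [set: R] (feresu a).
Proof.
apply: measurable_funM => //; apply: measurable_funD => //.
apply: measurable_funM => //; apply: measurableT_comp measurable_inv _.
apply: measurable_funM; first by apply: continuous_measurable_fun; exact: continuous_sin.
apply: measurableT_comp measurable_inv _.
by apply: continuous_measurable_fun; exact: continuous_cos.
Qed.

Lemma measurable_feresp i : measurable_fun [set: R] (feresp alpha i).
Proof.
have mu a := measurable_feresu a.
have muN a : measurable_fun [set: R] (fun x => feresu a (- x)).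
  exact: measurableT_comp (mu a) _.
case: i => [[|[|[|[|]]]] // i4]; rewrite /feresp /=;
  repeat (apply: measurable_fun_ifT => //; try exact: measurable_fun_ltr);
  try apply: measurable_funB => //; try exact: measurable_funM.
Qed.

Lemma measurable_feresq i : measurable_fun [set: R] (q i).
Proof.
apply: measurable_fun_ifT => //.
  by apply: measurable_and; apply: measurable_fun_ltr.
apply: measurable_funM; first exact: measurable_feresp.
by apply: continuous_measurable_fun; exact: continuous_sin.
Qed.

(** This is [W * P f]. Symmetry of [P] with respect to [W dx] is symmetry of [feresQ] with respect
    to Lebesgue measure. *)
Definition feresQ f x := \sum_(i < 4) q i x * f (T i x).

(* At the points where [sinpos] vanishes all weights vanish, and the quotient
   is [0 / 0 = 0]. *)
Definition feresP f x := feresQ f x / sinpos x.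

Lemma measurable_feresQ f : measurable_fun [set: R] f ->
  measurable_fun [set: R] (feresQ f).
Proof.
move=> mf; apply: measurable_sum => i; apply: measurable_funM.
  exact: measurable_feresq.
exact: measurableT_comp mf (measurable_feresT i).
Qed.

Lemma measurable_feresP f : measurable_fun [set: R] f ->
  measurable_fun [set: R] (feresP f).
Proof.
move=> mf; apply: measurable_funM; first exact: measurable_feresQ.
exact: measurableT_comp measurable_inv measurable_sinpos.
Qed.

Lemma feresq_eq0 i x : sinpos x = 0 -> q i x = 0.
Proof.
rewrite -(sum_feresq halpha) => /eqP.
rewrite psumr_eq0; last by move=> j _; exact: feresq_ge0.
by move=> /allP/(_ i); rewrite mem_index_enum => /(_ isT)/eqP.
Qed.

Lemma feresq_le1 i x : q i x <= 1.
Proof.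
apply: le_trans (sinpos_le1 x); rewrite -(sum_feresq halpha) (bigD1 i)//=.
by rewrite lerDl sumr_ge0// => j _; exact: feresq_ge0.
Qed.

Lemma sinpos_feresP f x : sinpos x * feresP f x = feresQ f x.
Proof.
rewrite /feresP mulrC; have [s0|s0] := eqVneq (sinpos x) 0; last by rewrite divfK.
by rewrite s0 mulr0 /feresQ big1// => i _; rewrite feresq_eq0// mul0r.
Qed.

Lemma feresQ_ge0 f : (forall x, 0 <= f x) -> forall x, 0 <= feresQ f x.
Proof. by move=> f0 x; apply: sumr_ge0 => i _; rewrite mulr_ge0// feresq_ge0. Qed.

Lemma feresP_ge0 f : (forall x, 0 <= f x) -> forall x, 0 <= feresP f x.
Proof. by move=> f0 x; rewrite divr_ge0 ?feresQ_ge0 ?sinpos_ge0. Qed.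

Lemma feresQ1 x : feresQ (cst 1) x = sinpos x.
Proof. by rewrite -(sum_feresq halpha); apply: eq_bigr => i _; rewrite mulr1. Qed.

Lemma feresP_le1 f : (forall x, f x <= 1) -> forall x, feresP f x <= 1.
Proof.
move=> f1 x; rewrite /feresP; have := sinpos_ge0 x; rewrite le_eqVlt => /predU1P[s0|s0].
  by rewrite -s0 invr0 mulr0.
rewrite ler_pdivrMr// mul1r -feresQ1; apply: ler_sum => i _.
by rewrite ler_wpM2l// feresq_ge0.
Qed.

Lemma feresQ_sym f h :
  measurable_fun [set: R] f -> measurable_fun [set: R] h ->
  (forall x, 0 <= f x) -> (forall x, 0 <= h x) ->
  (\int[leb]_x (h x * feresQ f x)%:E = \int[leb]_x (feresQ h x * f x)%:E)%E.
Proof.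
move=> mf mh f0 h0; rewrite /feresQ.
under eq_integral do rewrite mulr_sumr -sumEFin.
under [RHS]eq_integral do rewrite mulr_suml -sumEFin.
have q0 i x : 0 <= q i x by exact: feresq_ge0.
have mfT i : measurable_fun [set: R] (fun x => f (T i x)).
  exact: measurableT_comp mf (measurable_feresT i).
have mhT i : measurable_fun [set: R] (fun x => h (T i x)).
  exact: measurableT_comp mh (measurable_feresT i).
have mq i := measurable_feresq i.
have t1 i x : 0 <= h x * (q i x * f (T i x)) by rewrite mulr_ge0// mulr_ge0.
have t2 i x : 0 <= q i x * h (T i x) * f x by rewrite mulr_ge0// mulr_ge0.
have m1 i : measurable_fun [set: R] (fun x => (h x * (q i x * f (T i x)))%:E).
  by apply/measurable_EFinP; do 2?[apply: measurable_funM => //].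
have m2 i : measurable_fun [set: R] (fun x => (q i x * h (T i x) * f x)%:E).
  by apply/measurable_EFinP; do 2?[apply: measurable_funM => //].
rewrite ge0_integral_sum//; last by move=> i x _; rewrite lee_fin.
rewrite ge0_integral_sum//; last by move=> i x _; rewrite lee_fin.
rewrite (reindex_inj (inv_inj feresinvK)); apply: eq_bigr => i _.
rewrite -[RHS](@ge0_integral_isometry _ (T (feresinv i)) setT)//; last 3 first.
- exact: measurable_feresT.
- exact: lebesgue_measure_feresT.
- by move=> x _; rewrite lee_fin.
rewrite preimage_setT; apply: eq_integral => x _; congr EFin.
have -> : q i (T (feresinv i) x) = q (feresinv i) x.
  by have := feresq_sym halpha (feresinv i) x; rewrite feresinvK.
have -> : T i (T (feresinv i) x) = x.
  by have := feresTK alpha (feresinv i) x; rewrite feresinvK.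
by ring.
Qed.

Let eq_le (x y : R) : x = y -> x <= y. Proof. by move=> ->. Qed.

(** A variance inequality at the point [x]: by Lagrange's identity [W * Q (f^2) - (Q f)^2] is half
    the sum of [q_a * q_b * (f o T_a - f o T_b)^2], of which the terms (i, j) and (j, i) are
    kept. *)
Lemma feresQ_energy f x i j : i != j ->
  q i x * q j x * (f (T i x) - f (T j x)) ^+ 2 + sinpos x * feresP f x ^+ 2
  <= feresQ (fun y => f y ^+ 2) x.
Proof.
move=> ij; have q0 k : 0 <= q k x by exact: feresq_ge0.
have [s0|sN0] := eqVneq (sinpos x) 0.
  rewrite s0 mul0r addr0 feresq_eq0// !mul0r.
  by rewrite feresQ_ge0// => y; exact: sqr_ge0.
have s0 : 0 < sinpos x by rewrite lt_neqAle eq_sym sN0 sinpos_ge0.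
set E := q i x * q j x * _; set S := feresQ _ x.
have E0 : 0 <= E by rewrite mulr_ge0 ?sqr_ge0// mulr_ge0.
have key : \sum_(a < 4) \sum_(b < 4) q a x * q b x * (f (T a x) - f (T b x)) ^+ 2 =
    2 * (sinpos x * S - feresQ f x ^+ 2).
  have -> : 2 * (sinpos x * S - feresQ f x ^+ 2) =
      sinpos x * S + S * sinpos x - feresQ f x * feresQ f x - feresQ f x * feresQ f x.
    by ring.
  rewrite -(sum_feresq halpha) /S /feresQ !big_distrlr/= -big_split -!sumrB/=.
  apply: eq_bigr => a _; rewrite -big_split -!sumrB/=.
  by apply: eq_bigr => b _; ring.
have double_sum (F : 'I_4 -> 'I_4 -> R) : (forall a b, 0 <= F a b) ->
    F i j + F j i <= \sum_(a < 4) \sum_(b < 4) F a b.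
  move=> F0; have le_row a b : F a b <= \sum_(b < 4) F a b.
    by rewrite (bigD1 b)//= lerDl sumr_ge0.
  apply: le_trans (lerD (le_row i j) (le_row j i)) _.
  rewrite [leRHS](bigD1 i)//= lerD2l [leRHS](bigD1 j) 1?eq_sym//= lerDl.
  by apply: sumr_ge0 => a _; apply: sumr_ge0 => b _.
have : 2 * E <= 2 * (sinpos x * S - feresQ f x ^+ 2).
  rewrite -key; apply: le_trans (double_sum _ _); last first.
    by move=> a b; rewrite mulr_ge0 ?sqr_ge0// mulr_ge0.
  by apply: eq_le; rewrite /E; ring.
rewrite ler_pM2l// => H; rewrite -(ler_pM2l s0).
(* After multiplication by [W], the factor in front of [E] is dropped because [W <= 1]. *)
apply: le_trans (_ : E + feresQ f x ^+ 2 <= _); last by lra.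
rewrite mulrDr lerD//; first by rewrite ler_piMl// sinpos_le1.
by rewrite -sinpos_feresP [leRHS]exprMn mulrA -expr2.
Qed.

Definition feres_energy f := (\int[leb]_x (sinpos x * f x ^+ 2)%:E)%E.

Lemma le_feres_energy f i j : i != j -> measurable_fun [set: R] f ->
  (\int[leb]_x (q i x * q j x * (f (T i x) - f (T j x)) ^+ 2)%:E
   + feres_energy (feresP f) <= feres_energy f)%E.
Proof.
move=> ij mf; have mf2 : measurable_fun [set: R] (fun y => f y ^+ 2).
  exact: measurable_funX.
have q0 k x : 0 <= q k x by exact: feresq_ge0.
(* Symmetry with [h = 1], that is, invariance of the measure [W dx]. *)
have -> : feres_energy f = (\int[leb]_x (feresQ (fun y => f y ^+ 2) x)%:E)%E.
  under [RHS]eq_integral do rewrite -[feresQ _ _]mul1r.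
  rewrite (@feresQ_sym _ (cst 1))//; last by move=> x; exact: sqr_ge0.
  by apply: eq_integral => x _; rewrite feresQ1.
have mfT k : measurable_fun [set: R] (fun x => f (T k x)).
  exact: measurableT_comp mf (measurable_feresT k).
have m1 : measurable_fun [set: R]
    (fun x => q i x * q j x * (f (T i x) - f (T j x)) ^+ 2).
  apply: measurable_funM.
    by apply: measurable_funM; exact: measurable_feresq.
  by apply: measurable_funX; apply: measurable_funB.
have m2 : measurable_fun [set: R] (fun x => sinpos x * feresP f x ^+ 2).
  apply: measurable_funM; first exact: measurable_sinpos.
  by apply: measurable_funX; exact: measurable_feresP.
rewrite -ge0_integralD//; last 4 first.
- by move=> x _; rewrite lee_fin mulr_ge0 ?sqr_ge0// mulr_ge0.
- exact/measurable_EFinP.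
- by move=> x _; rewrite lee_fin mulr_ge0 ?sqr_ge0// sinpos_ge0.
- exact/measurable_EFinP.
apply: ge0_le_integral => //.
- move=> x _; rewrite lee_fin addr_ge0// mulr_ge0 ?sqr_ge0//.
    by rewrite mulr_ge0.
  exact: sinpos_ge0.
- by apply/measurable_EFinP; apply: measurable_funD.
- by apply/measurable_EFinP; exact: measurable_feresQ.
- by move=> x _; rewrite -EFinD lee_fin feresQ_energy.
Qed.

End feres_operator.

(** * Weak convergence of the iterates *)

Lemma vanishes_le {R : realType} (u w : nat -> R) : vanishes u ->
  (forall n, `|w n| <= `|u n|) -> vanishes w.
Proof.
by move=> u0 wu; apply: vanishesP => e e0; exists u => // n; rewrite ler_wpDr// ltW.
Qed.

Lemma cvgr_sub0_vanishes {R : realType} (u : nat -> R) l :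
  vanishes (fun n => u n - l) -> u n @[n --> \oo] --> l.
Proof.
move=> V; have -> : u = (fun n => (u n - l) + l).
  by apply/funext => n; rewrite subrK.
by rewrite -[X in _ --> X]add0r; apply: cvgD; [exact: V|exact: cvg_cst].
Qed.

Section feres_iterates.
Context {R : realType} (alpha : R).
Hypothesis halpha : 0 < alpha < pi / 6.
Hypothesis hirr : irrational (alpha / pi).
Local Notation leb := (@lebesgue_measure R).
Local Notation T := (feresT alpha).
Local Notation q := (feresq alpha).
Implicit Types (h : R -> R) (i j : 'I_4) (x y : R) (n : nat).

Lemma integral_sinpos : (\int[leb]_x (sinpos x)%:E = 2%:E)%E.
Proof.
have /(congr1 (fun z => 2%:E * z)%E) := @probability_setT _ _ _ (@sine_measure R).
rewrite mule1 => <-; rewrite /= /sine_measure setTI muleA -EFinM divff// mul1e.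
rewrite [RHS]integral_mkcond; apply: eq_integral => x _.
rewrite patchE /sinpos; case: ifPn => xpi.
  by rewrite mem_set// /angles/= in_itv.
by rewrite memNset// /angles/= in_itv; exact/negP.
Qed.

Variable f0 : R -> R.
Hypothesis mf0 : measurable_fun [set: R] f0.
Hypothesis f0_ge0 : forall x, 0 <= f0 x.
Hypothesis f0_le1 : forall x, f0 x <= 1.

Let f n := iter n (feresP alpha) f0.

Let mf n : measurable_fun [set: R] (f n).
Proof. by elim: n => // n IH; exact: measurable_feresP. Qed.

Let f_ge0 n x : 0 <= f n x.
Proof. by elim: n x => // n IH x; exact: feresP_ge0. Qed.

Let f_le1 n x : f n x <= 1.
Proof. by elim: n x => // n IH x; exact: feresP_le1. Qed.

Let mfT n i : measurable_fun [set: R] (fun x => f n (T i x)).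
Proof. exact: measurableT_comp (mf n) (measurable_feresT alpha i). Qed.

Let mphi n i j : measurable_fun [set: R] (fun x => f n (T i x) - f n (T j x)).
Proof. by apply: measurable_funB; exact: mfT. Qed.

Let phi_le1 n i j x : `|f n (T i x) - f n (T j x)| <= 1.
Proof.
have := (f_ge0 n (T i x), f_le1 n (T i x), f_ge0 n (T j x), f_le1 n (T j x)).
by move=> [[[? ?] ?] ?]; rewrite ler_norml; apply/andP; split; lra.
Qed.

Let energy_fin n : feres_energy (f n) \is a fin_num.
Proof.
rewrite ge0_fin_numE; last first.
  by apply: integral_ge0 => x _; rewrite lee_fin mulr_ge0 ?sqr_ge0 ?sinpos_ge0.
apply: (@le_lt_trans _ _ (\int[leb]_x (sinpos x)%:E)%E); last first.
  by rewrite integral_sinpos ltry.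
apply: ge0_le_integral => //.
- by move=> x _; rewrite lee_fin mulr_ge0 ?sqr_ge0 ?sinpos_ge0.
- apply/measurable_EFinP; apply: measurable_funM; first exact: measurable_sinpos.
  by apply: measurable_funX; exact: mf.
- by apply/measurable_EFinP; exact: measurable_sinpos.
- by move=> x _; rewrite lee_fin ler_piMr ?sinpos_ge0// exprn_ile1 ?f_ge0 ?f_le1.
Qed.

Let dissipation i j n :=
  (\int[leb]_x (q i x * q j x * (f n (T i x) - f n (T j x)) ^+ 2)%:E)%E.

Let q0 i x : 0 <= q i x. Proof. exact: feresq_ge0. Qed.

Let dissipation_ge0 i j n : (0 <= dissipation i j n)%E.
Proof.
by apply: integral_ge0 => x _; rewrite lee_fin mulr_ge0 ?sqr_ge0// mulr_ge0 ?q0.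
Qed.

Let dissipation_fin i j n : i != j -> dissipation i j n \is a fin_num.
Proof.
move=> ij; rewrite ge0_fin_numE ?dissipation_ge0//; apply: le_lt_trans (_ : feres_energy (f n) < +oo)%E.
  apply: le_trans (le_feres_energy halpha ij (mf n)); rewrite leeDl//.
  by apply: integral_ge0 => x _; rewrite lee_fin mulr_ge0 ?sqr_ge0 ?sinpos_ge0.
by rewrite ltey_eq energy_fin.
Qed.

(** The energies are nonnegative and nonincreasing, hence convergent, and the dissipation is bounded
    by their decrement. *)
Let dissipation_vanishes i j : i != j -> vanishes (fun n => fine (dissipation i j n)).
Proof.
move=> ij; pose a n := fine (feres_energy (f n)).
have le_a n : fine (dissipation i j n) + a n.+1 <= a n.
  rewrite /a -fineD ?energy_fin ?dissipation_fin//.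
  rewrite fine_le ?energy_fin//; last exact: le_feres_energy.
  by rewrite fin_numD energy_fin dissipation_fin.
have a_ge0 n : 0 <= a n.
  apply: fine_ge0; apply: integral_ge0 => x _.
  by rewrite lee_fin mulr_ge0 ?sqr_ge0 ?sinpos_ge0.
have d_ge0 n : 0 <= fine (dissipation i j n) by apply: fine_ge0; exact: dissipation_ge0.
have na : nonincreasing_seq a.
  apply/nonincreasing_seqP => n; have := le_a n; have := d_ge0 n; lra.
have ca : cvgn a.
  by apply: nonincreasing_is_cvgn => //; exists 0 => _ [n _ <-]; exact: a_ge0.
have Va : vanishes (fun n => a n - a n.+1).
  have -> : (fun n => a n - a n.+1) = a \- (fun n => a n.+1) by [].
  rewrite /vanishes -(subrr (limn a)); apply: cvgB => //.
  by rewrite (@cvg_shiftS _ a).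
apply: vanishes_le Va _ => n; rewrite !ger0_norm//; last by rewrite subr_ge0 na.
by have := le_a n; lra.
Qed.

Let itv_fin (a b : R) (b1 b2 : bool) :
  (leb [set` Interval (BSide b1 a) (BSide b2 b)] < +oo)%E.
Proof. by rewrite lebesgue_measure_itv/=; case: ifP => _; rewrite ?ltry// -EFinB ltry. Qed.

(** The dissipation is weighted by [q i * q j], which may degenerate at the ends of the interval;
    [vanishes_weighted] removes the weight. *)
Let pair_vanishes i j (a b : R) : i != j ->
  (forall x, a < x < b -> 0 < q i x * q j x) ->
  vanishes (fun n => \int[leb]_(x in `]a, b[) `|f n (T i x) - f n (T j x)|).
Proof.
move=> ij qij; have mq : measurable_fun [set: R] (fun x => q i x * q j x).
  by apply: measurable_funM; exact: measurable_feresq.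
have mD : measurable (`]a, b[%classic : set R) by exact: measurable_itv.
apply: (@vanishes_weighted _ _ _ leb `]a, b[%classic mD (itv_fin _ _ _ _)
  (fun n x => f n (T i x) - f n (T j x)) _ _ (fun x => q i x * q j x)).
- by move=> n; exact: measurable_funTS (mphi n i j).
- by move=> n x _; exact: phi_le1.
- exact: measurable_funTS mq.
- move=> x /=; rewrite in_itv/= => xab; rewrite qij//= mulr_ile1//; exact: feresq_le1.
apply: vanishes_le (dissipation_vanishes ij) _ => n.
have t0 x : 0 <= q i x * q j x * (f n (T i x) - f n (T j x)) ^+ 2.
  by rewrite mulr_ge0 ?sqr_ge0// mulr_ge0 ?q0.
have mt : measurable_fun [set: R]
    (fun x => (q i x * q j x * (f n (T i x) - f n (T j x)) ^+ 2)%:E).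
  apply/measurable_EFinP; apply: measurable_funM => //.
  by apply: measurable_funX; exact: mphi.
have le1 : (\int[leb]_(x in `]a, b[)
    (q i x * q j x * (f n (T i x) - f n (T j x)) ^+ 2)%:E <= dissipation i j n)%E.
  by apply: ge0_subset_integral => //; move=> x _; rewrite lee_fin.
have ge1 : (0 <= \int[leb]_(x in `]a, b[)
    (q i x * q j x * (f n (T i x) - f n (T j x)) ^+ 2)%:E)%E.
  by apply: integral_ge0 => x _; rewrite lee_fin.
rewrite !ger0_norm; last 2 first.
- by apply: fine_ge0.
- by apply: fine_ge0.
rewrite /Rintegral fine_le//; last exact: dissipation_fin.
rewrite ge0_fin_numE//; apply: le_lt_trans le1 _.
by rewrite ltey_eq dissipation_fin.
Qed.

Let Phi n x := \int[leb]_(t in `]0, x[) f n t.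

Let f_int n (a b : R) (b1 b2 : bool) :
  leb.-integrable [set` Interval (BSide b1 a) (BSide b2 b)] (EFin \o f n).
Proof.
apply: (@bounded_integrable _ _ _ leb _ _ (itv_fin _ _ _ _) _ 1) => //.
  exact: measurable_funTS (mf n).
by move=> x _; rewrite ger0_norm.
Qed.

Let Phi_sub n x y : 0 <= x <= y -> Phi n y - Phi n x = \int[leb]_(t in `]x, y[) f n t.
Proof.
move=> /andP[x0]; rewrite le_eqVlt => /predU1P[<-|xy].
  by rewrite subrr set_itv_ge ?Rintegral_set0// bnd_simp ltxx.
have -> : Phi n x = \int[leb]_(t in `]0, x]) f n t.
  by rewrite /Phi Rintegral_itv_bndo_bndc//; exact: f_int.
by rewrite /Phi Rintegral_itvB// ?bnd_simp//; exact: f_int.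
Qed.

Let Phi_bnd n x y : 0 <= x <= y -> 0 <= Phi n y - Phi n x <= y - x.
Proof.
move=> /[dup] /andP[x0 xy] xy'; rewrite Phi_sub//; apply/andP; split.
  exact: Rintegral_ge0.
apply: le_trans (_ : \int[leb]_(t in `]x, y[) 1 <= _).
  apply: le_Rintegral; [exact: measurable_itv|exact: f_int| |by move=> t _; exact: f_le1].
  by apply: (@bounded_integrable _ _ _ leb _ _ (itv_fin _ _ _ _) (cst 1) `|1|).
rewrite Rintegral_cst// mul1r.
have -> // : fine (leb `]x, y[%classic) = y - x.
rewrite lebesgue_measure_itv/= lte_fin.
by case: ltgtP xy => //= -> _; rewrite subrr.
Qed.

Let Rintegral_feresT n i (a b a' b' : R) :
  T i @^-1` `]a', b'[%classic = `]a, b[%classic ->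
  \int[leb]_(x in `]a, b[) f n (T i x) = \int[leb]_(x in `]a', b'[) f n x.
Proof.
move=> <-; congr fine; apply: (@ge0_integral_isometry _ _ _ (EFin \o f n)) => //.
- exact: measurable_feresT.
- exact: lebesgue_measure_feresT.
- by apply/measurable_EFinP; exact: measurable_funTS (mf n).
- by move=> x _; rewrite lee_fin f_ge0.
Qed.

Let pair_subinterval_vanishes i j (a b c d : R) : i != j ->
  (forall x, a < x < b -> 0 < q i x * q j x) -> a <= c -> d <= b ->
  vanishes (fun n => \int[leb]_(x in `]c, d[) f n (T i x) -
                     \int[leb]_(x in `]c, d[) f n (T j x)).
Proof.
move=> ij qij ac db; apply: vanishes_le (pair_vanishes ij qij) _ => n.
have fT_int k : leb.-integrable `]c, d[ (EFin \o (fun x => f n (T k x))).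
  apply: (@bounded_integrable _ _ _ leb _ _ (itv_fin _ _ _ _) _ 1) => //.
    exact: measurable_funTS (mfT n k).
  by move=> x _; rewrite ger0_norm.
have phi_int (a' b' : R) : leb.-integrable `]a', b'[ (EFin \o (fun x => f n (T i x) - f n (T j x))).
  apply: (@bounded_integrable _ _ _ leb _ _ (itv_fin _ _ _ _) _ 1) => //.
  exact: measurable_funTS (mphi n i j).
have sub : (`]c, d[%classic : set R) `<=` `]a, b[%classic.
  by apply: subset_itv; rewrite bnd_simp.
rewrite -RintegralB//; apply: le_trans (le_normr_Rintegral _ (phi_int _ _)) _.
  exact: measurable_itv.
rewrite ger0_norm; last by apply: Rintegral_ge0 => x _.
rewrite /Rintegral fine_le//.
- exact: integrable_fin_num (integrable_norm (phi_int _ _)).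
- exact: integrable_fin_num (integrable_norm (phi_int _ _)).
apply: ge0_subset_integral => //.
apply/measurable_EFinP; apply: measurableT_comp => //.
exact: measurable_funTS (mphi n i j).
Qed.

Let Phi_linear x y : 0 <= x <= pi -> 0 <= y <= pi ->
  vanishes (fun n => Phi n y - Phi n x
    - (y - x) * ((Phi n (5 * alpha) - Phi n alpha) / (4 * alpha))).
Proof.
have [a0 a6] := andP halpha.
apply: (asymptotically_linear halpha hirr)
  => {x y} [n x y xy _|x /andP[x1 x2]|x /andP[x1 x2]|x /andP[x1 x2]].
- exact: Phi_bnd.
- have qij z : 2 * alpha < z < pi - 2 * alpha ->
      0 < q (@Ordinal 4 0 isT) z * q (@Ordinal 4 2 isT) z.
    move=> /andP[z1 z2]; rewrite mulr_gt0//.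
      by apply: feresq0_gt0 => //; apply/andP; split; lra.
    by apply: feresq2_gt0 => //; apply/andP; split; lra.
  (* [T_1] maps ]2 alpha, x + 2 alpha[ onto ]4 alpha, x + 4 alpha[ and [T_3] maps it onto ]0, x[. *)
  have V := @pair_subinterval_vanishes (@Ordinal 4 0 isT) (@Ordinal 4 2 isT)
    _ _ (2 * alpha) (x + 2 * alpha) isT qij.
  apply: vanishes_le (V _ _) _; [lra|lra|] => n.
  rewrite (@Rintegral_feresT _ _ _ _ (4 * alpha) (x + 4 * alpha)); last first.
    by apply/seteqP; split => z; rewrite /= !in_itv/= /feresT/= => /andP[? ?];
      apply/andP; split; lra.
  rewrite (@Rintegral_feresT _ _ _ _ 0 x); last first.
    by apply/seteqP; split => z; rewrite /= !in_itv/= /feresT/= => /andP[? ?];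
      apply/andP; split; lra.
  rewrite -!Phi_sub; try by apply/andP; split; lra.
  by rewrite le_eqVlt; apply/orP; left; apply/eqP; congr `| _ |; ring.
- have qij z : alpha < z < 3 * alpha ->
      0 < q (@Ordinal 4 0 isT) z * q (@Ordinal 4 3 isT) z.
    move=> /andP[z1 z2]; rewrite mulr_gt0//.
      by apply: feresq0_gt0 => //; apply/andP; split; lra.
    by apply: feresq3_gt0 => //; apply/andP; split; lra.
  (* [T_1] maps ]alpha, x - 2 alpha[ onto ]3 alpha, x[ and [T_4] maps it onto the mirror image ]6
     alpha - x, 3 alpha[. *)
  have V := @pair_subinterval_vanishes (@Ordinal 4 0 isT) (@Ordinal 4 3 isT)
    _ _ alpha (x - 2 * alpha) isT qij.
  apply: vanishes_le (V _ _) _; [lra|lra|] => n.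
  rewrite (@Rintegral_feresT _ _ _ _ (3 * alpha) x); last first.
    by apply/seteqP; split => z; rewrite /= !in_itv/= /feresT/= => /andP[? ?];
      apply/andP; split; lra.
  rewrite (@Rintegral_feresT _ _ _ _ (6 * alpha - x) (3 * alpha)); last first.
    by apply/seteqP; split => z; rewrite /= !in_itv/= /feresT/= => /andP[? ?];
      apply/andP; split; lra.
  rewrite -!Phi_sub; try by apply/andP; split; lra.
  by rewrite le_eqVlt; apply/orP; left; apply/eqP; congr `| _ |; ring.
- have qij z : pi - 3 * alpha < z < pi - alpha ->
      0 < q (@Ordinal 4 1 isT) z * q (@Ordinal 4 2 isT) z.
    move=> /andP[z1 z2]; rewrite mulr_gt0//.
      by apply: feresq1_gt0 => //; apply/andP; split; lra.
    by apply: feresq2_gt0 => //; apply/andP; split; lra.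
  (* [T_3] maps ]x + 2 alpha, pi - alpha[ onto ]x, pi - 3 alpha[ and [T_2] maps it onto the mirror
     image about pi - 3 alpha. *)
  have V := @pair_subinterval_vanishes (@Ordinal 4 1 isT) (@Ordinal 4 2 isT)
    _ _ (x + 2 * alpha) (pi - alpha) isT qij.
  apply: vanishes_le (V _ _) _; [lra|lra|] => n.
  rewrite (@Rintegral_feresT _ _ _ _ (pi - 3 * alpha) (2 * pi - 6 * alpha - x)); last first.
    by apply/seteqP; split => z; rewrite /= !in_itv/= /feresT/= => /andP[? ?];
      apply/andP; split; lra.
  rewrite (@Rintegral_feresT _ _ _ _ x (pi - 3 * alpha)); last first.
    by apply/seteqP; split => z; rewrite /= !in_itv/= /feresT/= => /andP[? ?];
      apply/andP; split; lra.
  rewrite -!Phi_sub; try by apply/andP; split; lra.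
  by rewrite le_eqVlt; apply/orP; left; apply/eqP; congr `| _ |; ring.
Qed.

(** The mean of [f n] over [alpha, 5 alpha], asymptotically its mean over every interval. Its
    convergence is not yet known. *)
Let slope n := (Phi n (5 * alpha) - Phi n alpha) / (4 * alpha).

Let slope_itv n : 0 <= slope n <= 1.
Proof.
have [a0 a6] := andP halpha.
have /andP[h1 h2] : 0 <= Phi n (5 * alpha) - Phi n alpha <= 5 * alpha - alpha.
  by apply: Phi_bnd; apply/andP; split; lra.
rewrite /slope ler_pdivrMr; last by lra.
rewrite divr_ge0//; lra.
Qed.

Let centered n x := f n x - slope n.

Let centered_le1 n x : `|centered n x| <= 1.
Proof.
have := (f_ge0 n x, f_le1 n x); have /andP[? ?] := slope_itv n.
by move=> [? ?]; rewrite /centered ler_norml; apply/andP; split; lra.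
Qed.

Let mcentered n : measurable_fun [set: R] (centered n).
Proof. by apply: measurable_funB => //; exact: mf. Qed.

Let centered_vanishes (a b : R) : 0 <= a <= b -> b <= pi ->
  vanishes (fun n => \int[leb]_(x in `]a, b]) centered n x).
Proof.
move=> /andP[a0 ab] bpi.
have V := Phi_linear (x := a) (y := b).
apply: vanishes_le (V _ _) _ => [||n]; [by apply/andP; split; lra..|].
rewrite Phi_sub ?a0// Rintegral_itv_bndo_bndc; last exact: f_int.
have e : fine (leb `]a, b]%classic) = b - a.
  rewrite lebesgue_measure_itv/= lte_fin.
  by case: ltgtP ab => //= -> _; rewrite subrr.
rewrite /centered RintegralB; [|exact: measurable_itv|exact: f_int|]; last first.
  by apply: (@bounded_integrable _ _ _ leb _ _ (itv_fin _ _ _ _) (cst (slope n)) `|slope n|).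
by rewrite Rintegral_cst// e mulrC.
Qed.

(** Half-open like the generators [ocitv], so that intersecting with one again gives such an
    interval; the added point pi carries no weight, as [sinpos pi = 0]. *)
Let D : set R := `]0, pi]%classic.

Let centered_set_vanishes E : measurable E ->
  vanishes (fun n => \int[leb]_(x in D `&` E) centered n x).
Proof.
have [a0 a6] := andP halpha.
have mD : measurable D by exact: measurable_itv.
move=> mE; apply: (@vanishes_Rintegral_set _ _ _ leb D mD (itv_fin _ _ _ _) centered
  _ _ (@ocitv R)) => //.
- by move=> n; exact: measurable_funTS (mcentered n).
- exact: ocitvI.
- by apply: centered_vanishes; rewrite ?lexx//; lra.
move=> _ [[a b]] _ <-.
have -> : D `&` `](a, b).1, (a, b).2]%classic = `]Num.max 0 a, Num.min b pi]%classic.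
  apply/seteqP; split => x.
    rewrite /D /= !in_itv/= gt_max le_min => -[/andP[h1 h2] /andP[h3 h4]].
    by rewrite h1 h2 h3 h4.
  rewrite /D /= !in_itv/= gt_max le_min => /andP[/andP[h1 h2] /andP[h3 h4]].
  by rewrite h1 h2 h3 h4.
have [ab|ab] := leP (Num.max 0 a) (Num.min b pi).
  apply: centered_vanishes; first by rewrite ab le_max lexx.
  by rewrite ge_min lexx orbT.
rewrite set_itv_ge; last by rewrite bnd_simp -leNgt ltW.
by apply: vanishes_eq0 => n; rewrite Rintegral_set0.
Qed.

Let centered_integrable_vanishes h : leb.-integrable D (EFin \o h) ->
  vanishes (fun n => \int[leb]_(x in D) (h x * f n x) - slope n * \int[leb]_(x in D) h x).
Proof.
move=> hi; have mD : measurable D by exact: measurable_itv.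
have V : vanishes (fun n => \int[leb]_(x in D) (h x * centered n x)).
  exact: (@vanishes_Rintegral_integrable _ _ _ leb D mD (itv_fin _ _ _ _) centered
    (fun n => measurable_funTS (mcentered n)) (fun n x _ => centered_le1 n x) h hi
    centered_set_vanishes).
apply: vanishes_le V _ => n.
have hfi : leb.-integrable D (EFin \o (fun x => h x * f n x)).
  apply: (integrableMl (mu := leb) mD hi (measurable_funTS (mf n))).
  exists 1; split; first exact: num_real.
  by move=> x x1 y _ /=; rewrite ger0_norm ?f_ge0//; apply: le_trans (f_le1 _ _) (ltW x1).
under [X in _ <= `|X|]eq_Rintegral do rewrite /centered mulrBr.
rewrite RintegralB//; last exact: (integrableZr (mu := leb) mD (slope n) hi).
by rewrite RintegralZr// [slope n * _]mulrC.
Qed.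

Let sinposD h : (\int[leb]_x (sinpos x * h x)%:E = \int[leb]_(x in D) (sinpos x * h x)%:E)%E.
Proof.
rewrite [RHS]integral_mkcond; apply: eq_integral => x _; rewrite patchE.
case: ifPn => // /negP; rewrite inE /D/= in_itv/= => xD.
rewrite /sinpos ifF ?mul0r//; apply/negP => /andP[x0 xpi]; apply: xD.
by rewrite x0 ltW.
Qed.

Let sinpos_mass n :
  (\int[leb]_x (sinpos x * f n x)%:E = \int[leb]_x (sinpos x * f0 x)%:E)%E.
Proof.
elim: n => // n <-; rewrite /f iterS -/(f n).
transitivity (\int[leb]_x ((cst 1 x) * feresQ alpha (f n) x)%:E)%E.
  by apply: eq_integral => x _; rewrite sinpos_feresP// mul1r.
rewrite (feresQ_sym halpha)//.
by apply: eq_integral => x _; rewrite feresQ1.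
Qed.

(** The centred convergence is applied to [h] and to [sinpos]. For the latter the integral against
    [f n] is the constant [c] and the total mass is 2, so [slope n] tends to [c / 2]; a linear
    combination of the two eliminates [slope n]. *)
Lemma feres_weak_limit h : leb.-integrable D (EFin \o h) ->
  \int[leb]_(x in D) (h x * iter n (feresP alpha) f0 x) @[n --> \oo] -->
  \int[leb]_(x in D) h x * (2^-1 * \int[leb]_(x in D) (sinpos x * f0 x)).
Proof.
move=> hi; have mD : measurable D by exact: measurable_itv.
have si : leb.-integrable D (EFin \o @sinpos R).
  apply: (@bounded_integrable _ _ _ leb D mD (itv_fin _ _ _ _) _ 1).
    exact: measurable_funTS measurable_sinpos.
  by move=> x _; rewrite ger0_norm ?sinpos_ge0 ?sinpos_le1.
have s2 : \int[leb]_(x in D) sinpos x = 2.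
  rewrite /Rintegral -[RHS]/(fine 2%:E) -integral_sinpos; congr fine.
  under eq_integral do rewrite -[sinpos _]mulr1.
  rewrite -(sinposD (cst 1)); apply: eq_integral => x _.
  by rewrite /= mulr1.
set c := \int[leb]_(x in D) (sinpos x * f0 x).
have sc n : \int[leb]_(x in D) (sinpos x * f n x) = c.
  by rewrite /c /Rintegral -!sinposD sinpos_mass.
apply/cvgr_sub0_vanishes.
apply: (vanishes_lin (a := 1) (b := - (\int[leb]_(x in D) h x) / 2)
  (centered_integrable_vanishes hi) (centered_integrable_vanishes si)) => n.
by rewrite sc s2 -/(f n); field.
Qed.

End feres_iterates.

(** * Densities and rotations *)

Section set_function_integral.
Context {d} {T : measurableType d} {R : realType}.
Local Open Scope ereal_scope.

Import HBNNSimple.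

(* [m1] and [m2] are arbitrary set functions, so that [eq_measure_integral]
   does not apply. *)
Lemma eq_set_integral (m1 m2 : set T -> \bar R) D (f : T -> \bar R) :
  (forall A, measurable A -> m1 A = m2 A) ->
  integral m1 D f = integral m2 D f.
Proof.
move=> m12; have sE (h : {nnsfun T >-> R}) : sintegral m1 h = sintegral m2 h.
  by rewrite /sintegral; apply: eq_fsbigr => r _; rewrite m12.
by rewrite /integral; congr (ereal_sup _ - ereal_sup _);
  apply/seteqP; split => _ [h hf <-]; exists h.
Qed.

End set_function_integral.

(** * Probability measures given by a density *)

Section density_measure.
Context {R : realType}.
Local Open Scope ereal_scope.
Local Notation leb := (@lebesgue_measure R).
Variable rho : R -> R.

(** The proofs are arguments so that the structure of a probability measure can be attached to the
    set function. *)
Definition density_measure (mrho : measurable_fun [set: R] rho)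
    (rho0 : forall x, (0 <= rho x)%R)
    (rho1 : \int[leb]_x (rho x)%:E = 1) (B : set R) : \bar R :=
  \int[leb]_(x in B) (rho x)%:E.

Hypotheses (mrho : measurable_fun [set: R] rho)
  (rho_ge0 : forall x, (0 <= rho x)%R) (rho1 : \int[leb]_x (rho x)%:E = 1).

Local Notation mu := (density_measure mrho rho_ge0 rho1).

Let mu0 : mu set0 = 0.
Proof. exact: integral_set0. Qed.

Let mu_ge0 B : 0 <= mu B.
Proof. by apply: integral_ge0 => x _; rewrite lee_fin. Qed.

Let mu_sigma_additive : semi_sigma_additive mu.
Proof.
move=> F mF tF mUF; rewrite /density_measure ge0_integral_bigcup//; last 2 first.
- by apply/measurable_EFinP; exact: measurable_funTS mrho.
- by move=> x _; rewrite lee_fin.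
apply: cvg_toP => //.
by apply: is_cvg_ereal_nneg_natsum => n _; exact: (mu_ge0 (F n)).
Qed.

HB.instance Definition _ := isMeasure.Build _ _ _ mu mu0 mu_ge0 mu_sigma_additive.

Let muT : mu setT = 1. Proof. exact: rho1. Qed.

HB.instance Definition _ := Measure_isProbability.Build _ _ _ mu muT.

Import HBNNSimple.

(** Monotone convergence along simple functions reduces the claim to indicators, where it is the
    definition of the measure. *)
Lemma integral_density_measure (f : R -> \bar R) :
  measurable_fun [set: R] f -> (forall x, 0 <= f x) ->
  \int[mu]_x f x = \int[leb]_x (f x * (rho x)%:E).
Proof.
move=> mf f0; pose h := nnsfun_approx measurableT mf.
have hf x : EFin (h n x) @[n --> \oo] --> f x by exact: cvg_nnsfun_approx.
have nh x : {homo (fun n => (h n x)%:E) : n m / (n <= m)%N >-> n <= m}.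
  by move=> a b ab; rewrite lee_fin; exact/lefP/nd_nnsfun_approx.
have mh n : measurable_fun [set: R] (fun x => (h n x)%:E) by exact/measurable_EFinP.
have mrhoE : measurable_fun [set: R] (fun x => (rho x)%:E) by exact/measurable_EFinP.
transitivity (limn (fun n => \int[mu]_x (h n x)%:E)).
  rewrite -monotone_convergence//.
  - by apply: eq_integral => x _; apply/esym/cvg_lim.
  - by move=> n x _; rewrite lee_fin.
have m2 n : measurable_fun [set: R] (fun x => (h n x)%:E * (rho x)%:E).
  exact: emeasurable_funM (mh n) mrhoE.
have p2 n x : 0 <= (h n x)%:E * (rho x)%:E by rewrite mule_ge0// lee_fin.
have nd2 x : {homo (fun n => (h n x)%:E * (rho x)%:E) : n m / (n <= m)%N >-> n <= m}.
  by move=> a b ab; apply: lee_wpmul2r; [rewrite lee_fin|exact: nh].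
have -> : \int[leb]_x (f x * (rho x)%:E) =
    limn (fun n => \int[leb]_x ((h n x)%:E * (rho x)%:E)).
  rewrite -monotone_convergence//.
  apply: eq_integral => x _; apply/esym/cvg_lim => //.
  by apply: cvgeZr.
congr (limn _); apply/funext => n.
transitivity (\sum_(k \in range (h n)) \int[mu]_x (k * \1_(h n @^-1` [set k]) x)%:E).
  under eq_integral do rewrite fimfunE -fsumEFin//.
  rewrite ge0_integral_fsum//.
  - by move=> k; exact/measurable_EFinP/measurable_funM.
  - by move=> k x _; rewrite nnfun_muleindic_ge0.
transitivity (\sum_(k \in range (h n))
    \int[leb]_x ((k * \1_(h n @^-1` [set k]) x)%:E * (rho x)%:E)); last first.
  rewrite -ge0_integral_fsum//.
  - apply: eq_integral => x _; rewrite -ge0_mule_fsuml; last first.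
      by move=> k; rewrite nnfun_muleindic_ge0.
    by rewrite fsumEFin// -fimfunE.
  - move=> k; apply: emeasurable_funM (mrhoE).
    apply/measurable_EFinP; apply: measurable_funM; first exact: measurable_cst.
    exact: measurable_indic.
  - by move=> k x _; apply: mule_ge0; [exact: nnfun_muleindic_ge0|rewrite lee_fin].
apply: eq_fsbigr => k; rewrite inE => -[x _ hx].
have k0 : (0 <= k)%R by rewrite -hx.
have mi : measurable_fun [set: R] (fun y => (\1_(h n @^-1` [set k]) y : R)%:E).
  by apply/measurable_EFinP; exact: measurable_indic.
have i0 y : 0 <= (\1_(h n @^-1` [set k]) y : R)%:E.
  by rewrite lee_fin indicE; case: (_ \in _).
have mir := emeasurable_funM mi mrhoE.
have ir0 y : 0 <= (\1_(h n @^-1` [set k]) y : R)%:E * (rho y)%:E.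
  by rewrite mule_ge0// lee_fin.
under eq_integral do rewrite EFinM.
rewrite ge0_integralZl ?lee_fin// integral_indic// setIT.
under [RHS]eq_integral do rewrite EFinM -muleA.
rewrite ge0_integralZl ?lee_fin//.
congr (_ * _).
transitivity (\int[leb]_(x in h n @^-1` [set k]) (rho x)%:E); first by [].
rewrite [LHS]integral_mkcond; apply: eq_integral => y _.
by rewrite patchE indicE; case: (_ \in _); rewrite ?mul1e ?mul0e.
Qed.

End density_measure.

(** * Rotation invariance of the circle measure *)

Section circle_rotation.
Context {R : realType}.
Local Notation leb := (@lebesgue_measure R).
Implicit Types (s t x : R) (A : set R).

Let pi2_gt0 : 0 < 2 * pi :> R. Proof. by rewrite mulr_gt0 ?pi_gt0. Qed.

Lemma measurable_mod2pi : measurable_fun [set: R] (@mod2pi R).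
Proof.
apply: measurable_funB => //; apply: measurable_funM => //.
apply: (@measurableT_comp _ _ _ _ _ _ (fun y : R => (Num.floor y)%:~R : R)).
  apply: nondecreasing_measurable => // x y xy.
  by rewrite ler_int le_floor.
exact: measurable_funM.
Qed.

Lemma mod2pi_itv x : 0 <= mod2pi x < 2 * pi.
Proof.
have /andP[] := floor_itv (x / (2 * pi)).
rewrite intrD /mod2pi ler_pdivlMr// ltr_pdivrMr// => h1 h2.
by apply/andP; split; lra.
Qed.

Lemma mod2pi_unique x y (k : int) : 0 <= y < 2 * pi -> x = y + 2 * pi * k%:~R ->
  mod2pi x = y.
Proof.
move=> /andP[y0 y1] ->; rewrite /mod2pi (_ : Num.floor _ = k) ?addrK//.
apply: floor_def; rewrite intrD ler_pdivlMr// ltr_pdivrMr//.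
by apply/andP; split; lra.
Qed.

(** With [t] reduced to [t'] in [0, 2 pi), the rotation is a translation by [t'] before the
    wrap-around and by [t' - 2 * pi] after it. The two pieces are translated onto [t', 2 pi) and [0,
    t'). *)
Lemma circle_measure_rotation t A : measurable A ->
  circle_measure ((fun s => mod2pi (s + t)) @^-1` A) = circle_measure A.
Proof.
move=> mA; rewrite /circle_measure; congr (_ * _)%E.
have /andP[t0 t1] := mod2pi_itv t; set t' := mod2pi t in t0 t1.
pose k := Num.floor (t / (2 * pi)).
have tE : t = t' + 2 * pi * k%:~R by rewrite /t' /mod2pi subrK.
have rot1 s : 0 <= s + t' < 2 * pi -> mod2pi (s + t) = s + t'.
  by move=> h; apply: (mod2pi_unique (k := k)) h _; rewrite [in LHS]tE; ring.
have rot2 s : 0 <= s + (t' - 2 * pi) < 2 * pi -> mod2pi (s + t) = s + (t' - 2 * pi).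
  move=> h; apply: (mod2pi_unique (k := k + 1)) h _.
  by rewrite [in LHS]tE intrD; ring.
have mI (a b : R) : measurable (A `&` `[a, b[) by apply: measurableI.
have mS (u : R) B : measurable B -> measurable ((fun x => x + u) @^-1` B).
  move=> mB; rewrite -[X in measurable X]setTI.
  by apply: measurable_funD.
have -> : (fun s => mod2pi (s + t)) @^-1` A `&` positions =
    (fun x => x + t') @^-1` (A `&` `[t', 2 * pi[)
    `|` (fun x => x + (t' - 2 * pi)) @^-1` (A `&` `[0, t'[).
  apply/seteqP; split => s.
    rewrite /positions /= in_itv/= => -[As /andP[s0 s1]].
    have [st|st] := ltP (s + t') (2 * pi).
      left; rewrite in_itv/=; split; last by apply/andP; split; lra.
      by rewrite -(rot1 s)// st andbT; lra.
    right; rewrite in_itv/=; split; last by apply/andP; split; lra.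
    by rewrite -(rot2 s)//; apply/andP; split; lra.
  rewrite /positions /= !in_itv/= => -[[As /andP[s0 s1]]|[As /andP[s0 s1]]].
    by split; [rewrite rot1//|]; apply/andP; split; lra.
  by split; [rewrite rot2//|]; apply/andP; split; lra.
rewrite measureU//; [|exact: mS|exact: mS|]; last first.
  rewrite -subset0 => s [[_ /=]]; rewrite in_itv/= => /andP[? ?] [_ /=].
  by rewrite in_itv/= => /andP[? ?]; exfalso; lra.
transitivity (leb (A `&` `[t', 2 * pi[)%R + leb (A `&` `[0, t'[)%R)%E.
  by congr (_ + _)%E; exact: lebesgue_measure_shift.
rewrite -measureU; [|exact: mI|exact: mI|]; last first.
  rewrite -subset0 => s [[_ /=]]; rewrite in_itv/= => /andP[? ?] [_ /=].
  by rewrite in_itv/= => /andP[? ?]; exfalso; lra.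
suff -> : positions = `[t', 2 * pi[%classic `|` `[0, t'[%classic :> set R.
  by rewrite setIUr.
apply/seteqP; split => s; rewrite /positions /= !in_itv/=; last first.
  by move=> [/andP[? ?]|/andP[? ?]]; apply/andP; split; lra.
by move=> /andP[? ?]; have [?|?] := leP t' s; [left|right]; apply/andP; split.
Qed.

End circle_rotation.

(** * Evolution of measures *)

Section feres_evolution.
Context {R : realType} (alpha : R).
Hypothesis halpha : 0 < alpha < pi / 6.
Local Notation leb := (@lebesgue_measure R).
Local Notation T := (feresT alpha).
Local Notation q := (feresq alpha).
Local Notation P := (feresP alpha).
Implicit Types (f h phi : R -> R) (i : 'I_4) (x y : R) (n : nat).

Lemma feresP_sym n f h :
  measurable_fun [set: R] f -> measurable_fun [set: R] h ->
  (forall x, 0 <= f x) -> (forall x, 0 <= h x) ->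
  (\int[leb]_x (sinpos x * h x * iter n P f x)%:E =
   \int[leb]_x (sinpos x * iter n P h x * f x)%:E)%E.
Proof.
elim: n f h => // n IH f h mf mh f0 h0.
rewrite iterSr IH//; [|exact: measurable_feresP|exact: feresP_ge0].
have mPh : measurable_fun [set: R] (iter n P h).
  by elim: (n) => // m; exact: measurable_feresP.
have Ph0 : forall x, 0 <= iter n P h x.
  by elim: (n) => // m; exact: feresP_ge0.
transitivity (\int[leb]_x (iter n P h x * feresQ alpha f x)%:E)%E.
  by apply: eq_integral => x _; rewrite -(sinpos_feresP halpha); congr EFin; ring.
rewrite (feresQ_sym halpha)//; apply: eq_integral => x _.
by rewrite iterS (sinpos_feresP halpha).
Qed.

Variable g : R -> R.
Hypothesis g_meas : measurable_fun (angles : set R) g.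
Hypothesis g_ge0 : forall theta : R, angles theta -> 0 <= g theta.
Hypothesis g_int : (\int[sine_measure]_(theta in angles) (g theta)%:E = 1)%E.

Let g0 := g \_ (angles : set R).

Let mangles : measurable (angles : set R).
Proof. exact: measurable_itv. Qed.

Let mg0 : measurable_fun [set: R] g0.
Proof. by apply/(measurable_restrictT g mangles). Qed.

Let g0_ge0 x : 0 <= g0 x.
Proof. by rewrite /g0 patchE; case: ifPn => // /set_mem /g_ge0. Qed.

Let gn n := iter n P g0.

Let mgn n : measurable_fun [set: R] (gn n).
Proof. by elim: n => // n; exact: measurable_feresP. Qed.

Let gn_ge0 n x : 0 <= gn n x.
Proof. by elim: n x => // n IH x; exact: feresP_ge0. Qed.

Let sine_rho x := 2^-1 * sinpos x.

Let sine_rho_ge0 x : 0 <= sine_rho x.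
Proof. by rewrite mulr_ge0// sinpos_ge0. Qed.

Let msine_rho : measurable_fun [set: R] sine_rho.
Proof. by apply: measurable_funM => //; exact: measurable_sinpos. Qed.

Let sine_rho1 : (\int[leb]_x (sine_rho x)%:E = 1)%E.
Proof.
under eq_integral do rewrite EFinM.
rewrite ge0_integralZl//; last 2 first.
- by apply/measurable_EFinP; exact: measurable_sinpos.
- by move=> x _; rewrite lee_fin sinpos_ge0.
by rewrite integral_sinpos -EFinM mulVf.
Qed.

Local Notation sine_dens := (density_measure msine_rho sine_rho_ge0 sine_rho1).

Let sinpos_off x : ~ angles x -> sinpos x = 0.
Proof. by rewrite /angles/= in_itv/= /sinpos => /negP/negbTE ->. Qed.

Let sine_measureE B : measurable B -> sine_measure B = sine_dens B.
Proof.
move=> mB; rewrite /sine_measure -ge0_integralZl//; last 3 first.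
- exact: measurableI.
- apply/measurable_EFinP; apply: measurable_funTS.
  by apply: continuous_measurable_fun; exact: continuous_sin.
- by move=> x [_]; rewrite /angles/= in_itv/= lee_fin => /andP[? ?];
    rewrite sin_ge0_pi// !ltW.
rewrite integral_mkcondr; apply: eq_integral => x _; rewrite patchE /sine_rho.
case: ifPn => [/set_mem|/negP xa].
  by rewrite /angles/= in_itv/= /sinpos => ->; rewrite EFinM.
by rewrite sinpos_off ?mulr0// => xa'; apply: xa; exact: mem_set.
Qed.

Let integral_sine_measure f : measurable_fun [set: R] f -> (forall x, 0 <= f x) ->
  (\int[sine_measure]_x (f x)%:E = \int[leb]_x (f x * sine_rho x)%:E)%E.
Proof.
move=> mf f0; rewrite (eq_set_integral _ _ sine_measureE).
rewrite integral_density_measure//; exact/measurable_EFinP.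
Qed.

(** The Lebesgue density of the [n]-th iterate of [nu_2]: [P^n g] times the density of mu. *)
Let rho n x := gn n x * sine_rho x.

Let mrho n : measurable_fun [set: R] (rho n).
Proof. by apply: measurable_funM; [exact: mgn|exact: msine_rho]. Qed.

Let rho_ge0 n x : 0 <= rho n x.
Proof. by rewrite mulr_ge0 ?gn_ge0 ?sine_rho_ge0. Qed.

Let sine_densityE B : measurable B ->
  sine_density g B = (\int[leb]_(x in B) (rho 0 x)%:E)%E.
Proof.
move=> mB; rewrite /sine_density integral_mkcondr.
transitivity (\int[sine_measure]_x (g0 x * \1_B x)%:E)%E.
  rewrite integral_mkcond; apply: eq_integral => x _.
  rewrite /g0 !patchE indicE; case: (x \in B); last by rewrite mulr0.
  by rewrite mulr1; case: ifP.
rewrite integral_sine_measure.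
- rewrite [RHS]integral_mkcond; apply: eq_integral => x _.
  rewrite patchE indicE /rho /gn /=; case: (x \in B).
    by rewrite mulr1.
  by rewrite mulr0 mul0r.
- by apply: measurable_funM => //; exact: measurable_indic.
- by move=> x; rewrite mulr_ge0// ?g0_ge0// indicE; case: (_ \in _).
Qed.

(** Duality of one step: averaging [phi] over one move and integrating against [rho n] amounts to
    integrating [phi] against [rho n.+1]. *)
Let step phi n : measurable_fun [set: R] phi -> (forall x, 0 <= phi x) ->
  (\int[leb]_x (gn n x * (2^-1 * feresQ alpha phi x))%:E =
   \int[leb]_x (phi x * rho n.+1 x)%:E)%E.
Proof.
move=> mphi phi0.
transitivity (\int[leb]_x ((2^-1 * gn n x) * feresQ alpha phi x)%:E)%E.
  by apply: eq_integral => x _; congr EFin; ring.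
rewrite (feresQ_sym halpha)//; last 2 first.
- by apply: measurable_funM => //; exact: mgn.
- by move=> x; rewrite mulr_ge0 ?gn_ge0.
apply: eq_integral => x _; congr EFin; rewrite /rho /sine_rho /gn iterS -/(gn n).
have -> : feresQ alpha (fun x => 2^-1 * gn n x) x = 2^-1 * feresQ alpha (gn n) x.
  by rewrite /feresQ mulr_sumr; apply: eq_bigr => i _; ring.
by rewrite -(sinpos_feresP halpha); ring.
Qed.

Let rho1 n : (\int[leb]_x (rho n x)%:E = 1)%E.
Proof.
elim: n => [|n IH].
  rewrite -g_int -(sine_densityE measurableT) /sine_density setTI//.
rewrite -IH; under eq_integral do rewrite -[rho _ _]mul1r.
rewrite -(@step (cst 1))//; apply: eq_integral => x _.
by rewrite (feresQ1 halpha).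
Qed.

Local Notation M n := (density_measure (mrho n) (rho_ge0 n) (rho1 n)).

Let integral_M n f : measurable_fun [set: R] f -> (forall x, 0 <= f x) ->
  (\int[M n]_x (f x)%:E = \int[leb]_x (f x * rho n x)%:E)%E.
Proof.
move=> mf f0; rewrite integral_density_measure//; exact/measurable_EFinP.
Qed.

Let step_M phi n : measurable_fun [set: R] phi -> (forall x, 0 <= phi x) ->
  (\int[M n]_(x in angles) (\sum_(i < 4) feresp alpha i x * phi (T i x))%:E =
   \int[M n.+1]_x (phi x)%:E)%E.
Proof.
move=> mphi phi0.
(* Cut off outside (0, pi), where [feresp] has arbitrary values. Nonnegativity follows from
   [sinpos * F = feresQ phi] where [sinpos] is positive, and from the cutoff elsewhere. *)
pose F x := (fun x => \sum_(i < 4) feresp alpha i x * phi (T i x)) \_ (angles : set R) x.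
have mF : measurable_fun [set: R] F.
  apply/(measurable_restrictT _ mangles); apply: measurable_funTS.
  apply: measurable_sum => i; apply: measurable_funM; first exact: measurable_feresp.
  exact: measurableT_comp mphi (measurable_feresT alpha i).
have sinF x : sinpos x * F x = feresQ alpha phi x.
  rewrite /F patchE /feresQ; case: ifPn => [/set_mem|/negP xa].
    rewrite /angles/= in_itv/= => xpi; rewrite mulr_sumr; apply: eq_bigr => i _.
    by rewrite /feresq /sinpos xpi; ring.
  have s0 : sinpos x = 0.
    by apply: sinpos_off => xa'; apply: xa; exact: mem_set.
  by rewrite s0 mul0r big1// => i _; rewrite (feresq_eq0 halpha)// mul0r.
have F0 x : 0 <= F x.
  have [s0|s0] := eqVneq (sinpos x) 0.
    rewrite /F patchE; case: ifPn => // /set_mem.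
    rewrite /angles/= in_itv/= => xpi; move: s0; rewrite /sinpos xpi => s0.
    by have := sin_gt0_pi xpi; rewrite s0 ltxx.
  have sp : 0 < sinpos x by rewrite lt_neqAle eq_sym s0 sinpos_ge0.
  by rewrite -(pmulr_rge0 _ sp) sinF feresQ_ge0.
transitivity (\int[M n]_x (F x)%:E)%E.
  by rewrite integral_mkcond; apply: eq_integral => x _; rewrite /F !patchE; case: ifP.
rewrite integral_M// integral_M// -step//; apply: eq_integral => x _.
by congr EFin; rewrite -sinF /rho /sine_rho; ring.
Qed.

Lemma feres_evolE n B : measurable B ->
  feres_evol alpha (sine_density g) n B = M n B.
Proof.
elim: n B => [|n IH] B mB; first exact: sine_densityE.
rewrite /= (eq_set_integral _ _ IH) (@step_M (\1_B)).
- by rewrite integral_indic// setIT.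
- exact: measurable_indic.
- by move=> x; rewrite indicE; case: (_ \in _).
Qed.

Let nu : set (R * R) -> \bar R := (circle_measure \x sine_density g)%E.

Let billiardS (C : set (R * R)) y := fine (circle_measure (ysection C y)).

Let billiardSE C y : measurable C ->
  ((billiardS C y)%:E = circle_measure (ysection C y))%E.
Proof. by move=> mC; rewrite fineK// fin_num_measure//; exact: measurable_ysection. Qed.

Let billiardS_ge0 C y : 0 <= billiardS C y.
Proof. exact: fine_ge0. Qed.

Let mbilliardS C : measurable C -> measurable_fun [set: R] (billiardS C).
Proof.
move=> mC; have := measurable_fun_ysection (@circle_measure R) mC.
by move=> mS; exact: measurableT_comp (@fine_measurable R _ _) mS.
Qed.

Let mbilliardF i : measurable_fun [set: R * R] (billiardF alpha i).
Proof.
have mT : measurable_fun [set: R * R] (fun z => T i z.2).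
  exact: measurableT_comp (measurable_feresT alpha i) measurable_snd.
apply: measurable_fun_pair => //.
apply: (measurableT_comp (@measurable_mod2pi R)).
by apply: measurable_funD => //; apply: measurable_funM.
Qed.

(** For a fixed angle the position is rotated by [2 * T i y], which preserves the measure of the
    section of [C] at the new angle. *)
Let rotation_integral C i y : measurable C ->
  (\int[circle_measure]_s (\1_positions s * \1_C (billiardF alpha i (s, y)))%:E =
   (billiardS C (T i y))%:E)%E.
Proof.
move=> mC; rewrite billiardSE//.
have mS : measurable (ysection C (T i y)) by exact: measurable_ysection.
rewrite -(circle_measure_rotation (2 * T i y) mS).
set X := _ @^-1` _.
have mX : measurable X.
  rewrite -[X]setTI; apply: (measurableT_comp (@measurable_mod2pi R) _) => //.
  exact: measurable_funD.
have mposX : measurable (positions `&` X) by apply: measurableI => //; exact: measurable_itv.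
have -> : circle_measure X = circle_measure (positions `&` X).
  by rewrite /circle_measure setIAC setIid setIC.
rewrite -[X in circle_measure X]setIT -integral_indic//.
apply: eq_integral => s _; rewrite indicI /= !indicE.
suff -> : (billiardF alpha i (s, y) \in C) = (s \in X) by [].
apply/idP/idP => [/set_mem h|/set_mem h]; apply: mem_set.
  by rewrite /X/= /ysection/= inE.
by move: h; rewrite /X/= /ysection/= inE.
Qed.

Let feresp_angles i y : 0 <= feresp alpha i y * \1_angles y.
Proof.
rewrite indicE; case: (boolP (y \in _)) => [/set_mem|_]; last by rewrite mulr0.
rewrite mulr1 /angles/= in_itv/= => ypi.
have := feresq_ge0 halpha i y; rewrite /feresq ypi.
by rewrite pmulr_lge0// sin_gt0_pi.
Qed.

(** Integrating over the position first, rotation invariance leaves a function of the angle alone,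
    the measure of the section of [C]; the one-step duality [step_M] then moves from [M n] to
    [M n.+1]. *)
Lemma billiard_evolE n C : measurable C ->
  billiard_evol alpha nu n C = (circle_measure \x M n)%E C.
Proof.
elim: n C => [|n IH] C mC.
  (* [nu] is formed from the set function [sine_density g], which agrees with the measure [M 0] on
     the measurable sections. *)
  rewrite /= /nu /product_measure1; apply: eq_integral => s _ /=.
  by rewrite -feres_evolE//; exact: measurable_xsection.
rewrite /= (eq_set_integral _ _ IH).
pose w i y := feresp alpha i y * \1_angles y.
pose h i z := \1_positions z.1 * \1_C (billiardF alpha i z) : R.
pose G z := \sum_(i < 4) w i z.2 * h i z.
have mpos : measurable (positions : set R) by exact: measurable_itv.
have mw i : measurable_fun [set: R] (w i).
  by apply: measurable_funM; [exact: measurable_feresp|exact: measurable_indic].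
have mh i : measurable_fun [set: R * R] (h i).
  have m1 : measurable_fun [set: R] (\1_positions : R -> R).
    exact: measurable_indic.
  have m2 : measurable_fun [set: R * R] (\1_C : R * R -> R).
    exact: measurable_indic.
  apply: measurable_funM; first exact: (measurableT_comp m1 measurable_fst).
  exact: (measurableT_comp m2 (mbilliardF i)).
have h0 i z : 0 <= h i z.
  by rewrite /h !indicE; do 2 case: (_ \in _); rewrite ?mulr0 ?mul0r ?mulr1.
have mG : measurable_fun [set: R * R] (fun z => (G z)%:E).
  apply/measurable_EFinP; apply: measurable_sum => i; apply: measurable_funM => //.
  exact: (measurableT_comp (mw i) measurable_snd).
have G0 z : (0 <= (G z)%:E)%E.
  by rewrite lee_fin sumr_ge0// => i _; rewrite mulr_ge0// feresp_angles.
transitivity (\int[(circle_measure \x M n)%E]_z (G z)%:E)%E.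
  rewrite integral_mkcond; apply: eq_integral => z _; rewrite patchE /billiardK /G.
  case: ifPn => [/set_mem[z1 z2]|/negP zN].
    congr EFin; apply: eq_bigr => i _; rewrite /w /h !indicE (mem_set z1) (mem_set z2).
    by rewrite mulr1 mul1r.
  rewrite big1// => i _; rewrite /w /h !indicE.
  have [z2|z2] := boolP (z.2 \in angles); last by rewrite mulr0 mul0r.
  have [z1|z1] := boolP (z.1 \in positions); last by rewrite mul0r mulr0.
  by exfalso; apply: zN; apply: mem_set; split; exact: set_mem.
rewrite fubini_tonelli1// fubini_tonelli//.
transitivity (\int[M n]_y (\sum_(i < 4) w i y * billiardS C (T i y))%:E)%E.
  apply: eq_integral => y _; rewrite /G /=.
  under eq_integral do rewrite -sumEFin.
  have mhy i : measurable_fun [set: R] (fun s => h i (s, y)).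
    by apply: (measurableT_comp (mh i)); exact: measurable_pair2.
  have mhyE i : measurable_fun [set: R] (fun s => (h i (s, y))%:E).
    exact/measurable_EFinP.
  have mwhy i : measurable_fun [set: R] (fun s => (w i y * h i (s, y))%:E).
    by apply/measurable_EFinP; apply: measurable_funM.
  rewrite ge0_integral_sum//; last first.
    by move=> i s _; rewrite lee_fin mulr_ge0// feresp_angles.
  rewrite -sumEFin; apply: eq_bigr => i _.
  under eq_integral do rewrite EFinM.
  rewrite ge0_integralZl//; last 2 first.
  - by move=> s _; rewrite lee_fin.
  - by rewrite lee_fin feresp_angles.
  by rewrite rotation_integral.
transitivity (\int[M n.+1]_y (billiardS C y)%:E)%E.
  rewrite -step_M//; last exact: mbilliardS.
  rewrite [RHS]integral_mkcond; apply: eq_integral => y _.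
  rewrite patchE /w indicE; case: ifPn => ya.
    by congr EFin; apply: eq_bigr => i _; rewrite mulr1.
  by rewrite big1// => i _; rewrite mulr0 mul0r.
(* The other form of the product measure integrates sections over the angle, as obtained above. *)
rewrite (@product_measure_unique _ _ _ _ _ circle_measure (M n.+1)
  (circle_measure \x^ M n.+1)%E)//; last first.
  by move=> A1 A2 mA1 mA2; exact: product_measure2E.
by rewrite /product_measure2; apply: eq_integral => y _; rewrite billiardSE.
Qed.

Let D : set R := `]0, pi]%classic.

Let integral_D (F : R -> R) : (forall x, sinpos x = 0 -> F x = 0) ->
  (\int[leb]_x (F x)%:E = \int[leb]_(x in D) (F x)%:E)%E.
Proof.
move=> F0; rewrite [RHS]integral_mkcond; apply: eq_integral => x _; rewrite patchE.
case: ifPn => // /negP xD; rewrite F0//; apply: sinpos_off => xa; apply: xD.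
apply: mem_set; move: xa; rewrite /angles /D /= !in_itv/= => /andP[x0 xpi].
by rewrite x0 ltW.
Qed.

Let M_fin n B : measurable B -> M n B \is a fin_num.
Proof. by move=> mB; exact: fin_num_measure. Qed.

Let M_angles n : M n angles = 1%E.
Proof.
rewrite -(rho1 n) /density_measure integral_mkcond; apply: eq_integral => x _.
rewrite patchE; case: ifPn => // /negP xa; rewrite /rho /sine_rho sinpos_off ?mulr0//.
by move=> xa'; apply: xa; exact: mem_set.
Qed.

(** By symmetry [P^n] passes from the density to the indicator of [B], so the weak limit applies
    with [rho 0] as the integrable test function; its integral is 1. *)
Lemma feres_evol_cvg B : irrational (alpha / pi) -> measurable B ->
  M n B @[n --> \oo] --> sine_measure B.
Proof.
move=> hirr mB; have m1B : measurable_fun [set: R] (\1_B : R -> R).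
  exact: measurable_indic.
have B0 x : 0 <= (\1_B x : R) by rewrite indicE.
have B1 x : (\1_B x : R) <= 1 by rewrite indicE; case: (_ \in _).
have half_sym f : measurable_fun [set: R] f -> (forall x, 0 <= f x) ->
    (\int[leb]_x (2^-1 * f x)%:E = 2^-1%:E * \int[leb]_x (f x)%:E)%E.
  move=> mf f0; under eq_integral do rewrite EFinM.
  by rewrite ge0_integralZl//; [exact/measurable_EFinP|move=> x _; rewrite lee_fin].
have mPn n f : measurable_fun [set: R] f -> measurable_fun [set: R] (iter n P f).
  by move=> mf; elim: n => // n IH; exact: measurable_feresP.
have Pn0 n f : (forall x, 0 <= f x) -> forall x, 0 <= iter n P f x.
  by move=> f0; elim: n => // n IH; exact: feresP_ge0.
have ME n : M n B = (\int[leb]_(x in D) (rho 0 x * iter n P (\1_B) x)%:E)%E.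
  transitivity (\int[leb]_x (2^-1 * (sinpos x * gn n x * \1_B x))%:E)%E.
    rewrite /density_measure integral_mkcond; apply: eq_integral => x _.
    rewrite patchE indicE /rho /sine_rho; case: (x \in B); last by rewrite !mulr0.
    by congr EFin; rewrite /=; ring.
  rewrite half_sym; last 2 first.
  - apply: measurable_funM => //; apply: measurable_funM; last exact: mgn.
    exact: measurable_sinpos.
  - by move=> x; rewrite !mulr_ge0 ?sinpos_ge0 ?gn_ge0.
  rewrite -feresP_sym//.
  rewrite -half_sym; last 2 first.
  - apply: measurable_funM; last exact: mPn.
    by apply: measurable_funM => //; exact: measurable_sinpos.
  - by move=> x; apply: mulr_ge0; [rewrite mulr_ge0 ?sinpos_ge0|exact: Pn0].
  rewrite -integral_D; last by move=> x s0; rewrite /rho /sine_rho s0 mulr0 mulr0 mul0r.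
  by apply: eq_integral => x _; congr EFin; rewrite /rho /sine_rho /gn /=; ring.
have mD : measurable D by exact: measurable_itv.
have rho_off x : sinpos x = 0 -> rho 0 x = 0 by rewrite /rho /sine_rho => ->; rewrite !mulr0.
have hi : leb.-integrable D (EFin \o rho 0).
  apply/integrableP; split.
    by apply/measurable_EFinP; exact: measurable_funTS (mrho 0).
  under eq_integral do rewrite /= ger0_norm ?rho_ge0//.
  by rewrite -integral_D// rho1 ltry.
have := feres_weak_limit halpha hirr m1B B0 B1 hi.
have -> : \int[leb]_(x in D) rho 0 x = 1.
  by rewrite /Rintegral -integral_D// rho1.
rewrite mul1r => L.
(* The constant of the weak limit, half the integral of [sin] over [B], is mu(B). *)
have -> : sine_measure B = (2^-1 * \int[leb]_(x in D) (sinpos x * \1_B x))%:E.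
  rewrite sine_measureE//.
  have -> : sine_dens B = (\int[leb]_x (2^-1 * (sinpos x * \1_B x))%:E)%E.
    rewrite /density_measure integral_mkcond; apply: eq_integral => x _.
    rewrite patchE indicE /sine_rho; case: (x \in B); last by rewrite !mulr0.
    by rewrite mulr1.
  have m2 : measurable_fun [set: R] (fun x => sinpos x * \1_B x).
    by apply: measurable_funM => //; exact: measurable_sinpos.
  have p2 x : 0 <= sinpos x * \1_B x by rewrite mulr_ge0 ?sinpos_ge0.
  rewrite half_sym// EFinM; congr (_ * _)%E.
  rewrite /Rintegral -integral_D; last by move=> x ->; rewrite mul0r.
  rewrite fineK// ge0_fin_numE; last by apply: integral_ge0 => x _; rewrite lee_fin.
  apply: (@le_lt_trans _ _ (\int[leb]_x (sinpos x)%:E)%E); last first.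
    by rewrite integral_sinpos ltry.
  apply: ge0_le_integral => //.
  - by move=> x _; rewrite lee_fin.
  - exact/measurable_EFinP.
  - by apply/measurable_EFinP; exact: measurable_sinpos.
  - by move=> x _; rewrite lee_fin ler_piMr ?sinpos_ge0.
have MR n : M n B = (\int[leb]_(x in D) (rho 0 x * iter n P (\1_B) x))%:E.
  by rewrite /Rintegral -ME fineK ?M_fin.
under eq_cvg do rewrite MR.
by apply: cvg_EFin => //; exact: nearW.
Qed.

Lemma billiard_evol_product A B n : measurable A -> measurable B ->
  billiard_evol alpha nu n (A `*` B) =
  (circle_measure A * feres_evol alpha (sine_density g) n B)%E.
Proof.
move=> mA mB; rewrite billiard_evolE; last exact: measurableX.
by rewrite product_measure1E// feres_evolE.
Qed.

Lemma position_marginalE A n : measurable A ->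
  position_marginal (billiard_evol alpha nu n) A = circle_measure A.
Proof.
move=> mA; rewrite /position_marginal billiard_evol_product// feres_evolE//.
by rewrite M_angles mule1.
Qed.

Lemma billiard_evol_cvg A B : irrational (alpha / pi) ->
  measurable A -> measurable B ->
  billiard_evol alpha nu n (A `*` B) @[n --> \oo] -->
  (circle_measure \x sine_measure)%E (A `*` B).
Proof.
move=> hirr mA mB; rewrite product_measure1E//.
under eq_cvg do rewrite billiard_evol_product// feres_evolE//.
apply: cvgeZl; first exact: fin_num_measure.
exact: feres_evol_cvg.
Qed.

End feres_evolution.

Local Open Scope ereal_scope.

Theorem proposition6p1 (R : realType) (alpha : R)
    (halpha : (0 < alpha < pi / 6)%R)
    (hirr : irrational (alpha / pi)%R)
    (g : R -> R)
    (g_meas : measurable_fun (angles : set R) g)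
    (g_ge0 : forall theta : R, angles theta -> (0 <= g theta)%R)
    (g_int : \int[sine_measure]_(theta in angles) (g theta)%:E = 1)
    (A B : set R)
    (mA : measurable A) (sA : A `<=` positions)
    (mB : measurable B) (sB : B `<=` angles) :
  let nu2 : set R -> \bar R := sine_density g in
  let nu : set (R * R) -> \bar R := circle_measure \x nu2 in
  (forall n : nat,
     billiard_evol alpha nu n (A `*` B) =
     position_marginal (billiard_evol alpha nu n) A * feres_evol alpha nu2 n B)
  /\
  billiard_evol alpha nu n (A `*` B) @[n --> \oo]
    --> (circle_measure \x sine_measure) (A `*` B).
Proof.
move=> nu2 nu; split; last exact: billiard_evol_cvg.
by move=> n; rewrite billiard_evol_product// position_marginalE.
Qed.
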